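(* There is a randomized algorithm for the arbitrary CRCW PRAM that sorts an array of $n$ elements in $O(\log n)$ span with high probability in $n$ and $O(n\log n)$ expected work, when each of $n$ processors has $O(1)$ words of private memory. The algorithm is in-place: it allocates no shared memory aside from the input array.
   Context: PRAM model: synchronous processors with a shared memory, each processor also having its own private memory, measured in words. In the arbitrary CRCW (Concurrent-Read, Concurrent-Write) PRAM, processors may read and write the same shared location concurrently, and concurrent writes to one location are resolved by letting an arbitrary one of them succeed. The input is an array of $n$ elements from a totally ordered set in shared memory, each element fitting in one word, with comparisons taking constant time; the sorted sequence is to be produced in the same array. Processors may draw uniformly random indices in constant time. Work is the total number of operations performed; span is the maximum number of operations performed by a single processor when the number of processors is not bounded. An event holds with high probability (w.h.p.) in $n$ if it holds with probability greater than $1-1/n^{k}$ for some constant $k\ge 1$. *)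

(* Defs.v *)
From HB Require Import structures.
From mathcomp Require Import all_boot all_order all_algebra.
From mathcomp Require Import all_classical all_reals all_analysis.

Set Implicit Arguments.
Unset Strict Implicit.
Unset Printing Implicit Defensive.

Import Order.TTheory GRing.Theory Num.Theory.

(* MathComp-Analysis. *)

(* Programs.  A program has a fixed number r of private registers and a fixed
   finite code, neither of which depends on the input size; all processors run
   the same code.  Jump targets are positions in the code. *)

Variant arith := OpAdd | OpSub | OpMul | OpDiv | OpMod.

Variant instr (r : nat) :=
| Const of 'I_r & nat
| Pid of 'I_r
| Size of 'I_r
| Move of 'I_r & 'I_r
| Arith of arith & 'I_r & 'I_r & 'I_r
| Jump of nat
| JumpLe of 'I_r & 'I_r & nat
| Read of 'I_r & 'I_r
| Write of 'I_r & 'I_r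
| Rand of 'I_r
| Halt.

Arguments Const {r}.
Arguments Pid {r}.
Arguments Size {r}.
Arguments Move {r}.
Arguments Arith {r}.
Arguments Jump {r}.
Arguments JumpLe {r}.
Arguments Read {r}.
Arguments Write {r}.
Arguments Rand {r}.
Arguments Halt {r}.

Definition program (r : nat) := seq (instr r).

Definition eval_arith (o : arith) : nat -> nat -> nat :=
  match o with
  | OpAdd => addn | OpSub => subn | OpMul => muln
  | OpDiv => divn | OpMod => modn
  end.

(* A word holds either an array element or an integer.  Elements are opaque:
   programs can only copy and compare them. *)
Variant word (T : Type) := Elem of T | Int of nat.

Arguments Int {T}.

(* The word size is c times the length of n in binary, that is Theta(log n). *)
Definition word_bits (c n : nat) : nat := c * (trunc_log 2 n).+1.

Section Machine.
Variables (disp : Order.disp_t) (T : orderType disp).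
Variables (r : nat) (code : program r) (bits n : nat).

Record processor := Processor { pc : nat; regs : 'I_r -> word T }.

(* The n cells of the input array are the whole shared memory. *)
Record config := Config {
  procs : 'I_n -> processor;
  cells : 'I_n -> word T
}.

Definition int_word (k : nat) : word T := Int (k %% 2 ^ bits).

Definition fetch (s : processor) : instr r := nth Halt code (pc s).

Definition halted (s : processor) : bool :=
  if fetch s is Halt then true else false.

Definition address (v : word T) : option 'I_n :=
  if v is Int k then insub k else None.

(* None when an element is compared with an integer. *)
Definition word_le (u v : word T) : option bool :=
  match u, v with
  | Elem x, Elem y => Some (x <= y)%O
  | Int x, Int y => Some (x <= y)%N
  | _, _ => None
  end.

(* One operation of processor p, reading the shared memory m; u is the index
   obtained if the operation is Rand.  Invalid operations (arithmetic on
   elements, mixed comparisons, addresses outside the array) leave the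
   processor stuck at the same instruction, so that it never halts. *)
Definition proc_step (m : 'I_n -> word T) (u p : 'I_n) (s : processor) :
    processor :=
  let next := Processor (pc s).+1 (regs s) in
  let put d v := Processor (pc s).+1 [eta regs s with d |-> v] in
  match fetch s with
  | Const d k => put d (int_word k)
  | Pid d => put d (int_word p)
  | Size d => put d (int_word n)
  | Move d a => put d (regs s a)
  | Arith o d a b =>
      match regs s a, regs s b with
      | Int x, Int y => put d (int_word (eval_arith o x y))
      | _, _ => s
      end
  | Jump l => Processor l (regs s)
  | JumpLe a b l =>
      match word_le (regs s a) (regs s b) with
      | Some true => Processor l (regs s)
      | Some false => next
      | None => s
      end
  | Read d a => if address (regs s a) is Some i then put d (m i) else s
  | Write a _ => if address (regs s a) is Some _ then next else s
  | Rand d => put d (int_word u)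
  | Halt => s
  end.

(* The cell and the value that s is about to write, if any. *)
Definition write_of (s : processor) : option ('I_n * word T) :=
  if fetch s is Write a b then
    omap (fun i => (i, regs s b)) (address (regs s a))
  else None.

Definition writes_to (s : processor) (i : 'I_n) : bool :=
  if write_of s is Some (j, _) then j == i else false.

(* One synchronous step: reads see the memory before the step, and at each
   cell i the write of processor win i takes effect. *)
Definition pram_step (u win : 'I_n -> 'I_n) (C : config) : config :=
  {| procs p := proc_step (cells C) (u p) p (procs C p);
     cells i :=
       if write_of (procs C (win i)) is Some (j, v)
       then if j == i then v else cells C i
       else cells C i |}.

(* Resolution of concurrent writes: given the past configurations (latest
   first) and the present one, selects for each cell the winning processor.
   It may depend on all random indices drawn so far, but not on later ones. *)
Definition arbiter := seq config -> config -> 'I_n -> 'I_n.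

Definition valid_arbiter (adv : arbiter) : Prop :=
  forall past C i, (exists p, writes_to (procs C p) i) ->
    writes_to (procs C (adv past C i)) i.

Definition init_config (input : n.-tuple T) : config :=
  {| procs _ := Processor 0 (fun _ => Int 0);
     cells i := Elem (tnth input i) |}.

Section Run.
Variables (adv : arbiter) (input : n.-tuple T) (u : nat -> 'I_n -> 'I_n).

(* The past configurations and the configuration after t steps, where u s p is
   the index available to processor p in step s. *)
Fixpoint run (t : nat) : seq config * config :=
  if t is s.+1 then
    let: (past, C) := run s in (C :: past, pram_step (u s) (adv past C) C)
  else ([::], init_config input).

Definition running (t : nat) (p : 'I_n) : bool :=
  ~~ halted (procs (run t).2 p).

Definition run_sorts : Prop :=
  exists t, (forall p, ~~ running t p) /\
    exists output : n.-tuple T,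
      [/\ sorted <=%O output, perm_eq output input
        & forall i, cells (run t).2 i = Elem (tnth output i)].

Local Open Scope ereal_scope.

Definition ops (R : realType) (p : 'I_n) : \bar R :=
  \sum_(0 <= t <oo) ((running t p)%:R)%:E.

Definition pram_span (R : realType) : \bar R :=
  \big[maxe/0]_(p < n) ops R p.

Definition pram_work (R : realType) : \bar R :=
  \sum_(p < n) ops R p.

End Run.
End Machine.

Local Open Scope classical_set_scope.
Local Open Scope ring_scope.
Local Open Scope ereal_scope.

(* The U t p are independent and uniformly distributed on the n indices. *)
Definition iid_uniform (R : realType) (d : measure_display)
    (Omega : measurableType d) (P : probability Omega R) (n : nat)
    (U : nat -> 'I_n -> Omega -> 'I_n) : Prop :=
  [/\ forall t p i, measurable [set w | U t p w = i],
      forall t p i, P [set w | U t p w = i] = (n%:R^-1)%:E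
    & forall (J : seq (nat * 'I_n)) (f : nat * 'I_n -> 'I_n), uniq J ->
        P [set w | forall j, j \in J -> U j.1 j.2 w = f j] =
        \prod_(j <- J) P [set w | U j.1 j.2 w = f j]].

(* Main.v *)
(* Every processor keeps its own element in a register, so the n cells serve as
   scratch memory until the output is written.  Processor 0 is the head of a
   linked list into which the other processors insert themselves: an unplaced
   processor x knows its gap, the largest placed processor below x, and the
   unplaced processors of one gap share a threshold, initially 1.  In each round
   those of them whose single random draw lies below the threshold write their
   number into the cell of the gap.  If one of them wins, it enters the list and
   splits the gap, otherwise the threshold is doubled.  At the end list ranking
   by pointer jumping gives every processor its rank.

   Let the level of w be the least j such that its draw is below 2^j.  While x
   waits, a processor w of its gap can be placed before x only if no processor
   strictly between w and x has a smaller level, however the arbiter resolves the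
   conflicts.  Reading the levels outwards from x in one direction, these w are
   weak prefix minima of an iid sequence in which level j is at most as likely as
   all lower levels together (up to the atom at level 0); the number W of minima
   satisfies E (3/2)^W <= 4n, hence is O(log n) for all x with probability
   1 - O(1/n).
   Since the number of rounds never exceeds O(n), this also bounds the expected
   work. *)
Require Import Defs.
From HB Require Import structures.
From mathcomp Require Import all_boot all_order all_algebra all_fingroup.
From mathcomp Require Import all_classical all_reals all_analysis.
From mathcomp Require Import measurable_realfun.
From mathcomp Require Import zify ring lra.

Set Implicit Arguments.
Unset Strict Implicit.
Unset Printing Implicit Defensive.

Import Order.TTheory GRing.Theory Num.Theory.

(** * Lockstep execution *)

(* [Sel d x y a b] puts [if x <= y then a else b] into register [d], and
   [Wr x y a b] writes register [b] to the cell addressed by [a] if [x <= y]. *)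
Variant stmt (r : nat) :=
| Ins of instr r
| Sel of 'I_r & 'I_r & 'I_r & 'I_r & 'I_r
| Wr of 'I_r & 'I_r & 'I_r & 'I_r.

Arguments Ins {r}.
Arguments Sel {r}.
Arguments Wr {r}.

(* Both branches of a conditional take three steps, so that processors that
   enter a block simultaneously also leave it simultaneously. *)
Definition asm r (l : nat) (s : stmt r) : program r :=
  match s with
  | Ins i => [:: i]
  | Sel d x y a b =>
      [:: JumpLe x y (l + 3); Move d b; Jump (l + 5); Move d a; Jump (l + 5)]
  | Wr x y a b =>
      [:: JumpLe x y (l + 3); Move a a; Jump (l + 5); Write a b; Jump (l + 5)]
  end.

Definition duration r (s : stmt r) : nat := if s is Ins _ then 1 else 3.

Fixpoint asms r (l : nat) (ss : seq (stmt r)) : program r :=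
  if ss is s :: ss' then asm l s ++ asms (l + size (asm l s)) ss' else [::].

Definition durations r (ss : seq (stmt r)) : nat := sumn (map (@duration r) ss).

Definition code_at r (code : program r) (l : nat) (c : program r) : Prop :=
  forall i, i < size c -> nth Halt code (l + i) = nth Halt c i.

Lemma code_at_drop r (code c : program r) l :
  take (size c) (drop l code) = c -> code_at code l c.
Proof.
move=> <- i; rewrite size_take_min leq_min => /andP[ic _].
by rewrite nth_take ?nth_drop.
Qed.

Lemma code_at_cat r (code c1 c2 : program r) l :
  code_at code l (c1 ++ c2) -> code_at code l c1 /\ code_at code (l + size c1) c2.
Proof.
move=> H; split=> i Hi.
- by rewrite H ?nth_cat ?Hi // size_cat ltn_addr.
- rewrite -addnA H ?size_cat ?ltn_add2l // nth_cat ltnNge leq_addr /=.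
  by rewrite addKn.
Qed.

Section Lockstep.
Variables (disp : Order.disp_t) (T : orderType disp).
Variables (r : nat) (code : program r) (bits n : nat).

Local Notation wrd := (word T).
Local Notation regfile := ('I_n -> seq wrd).
Local Notation memory := ('I_n -> wrd).
Local Notation reg s k := (nth (Int 0) s (nat_of_ord k)).
Local Notation put s d v := (set_nth (Int 0) s (nat_of_ord d) v).

Definition regs_of (s : seq wrd) : 'I_r -> wrd := fun k => reg s k.

Lemma regs_of_put s (d : 'I_r) v :
  [eta regs_of s with d |-> v] = regs_of (put s d v) :> ('I_r -> wrd).
Proof. by apply: funext => k; rewrite /regs_of nth_set_nth /=. Qed.

Definition aligned (l : nat) (F : regfile) (M : memory) : config T r n :=
  Config (fun p => Processor l (regs_of (F p))) M.

(** The existentials make every operation valid for all processors, so that none gets stuck. A write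
    must establish [Q] for each memory that some resolution of the conflicts can produce.
    Instructions that never serve as statements of a block get [False]. *)
Definition wp1 (s : stmt r) (Q : regfile -> memory -> Prop)
    (F : regfile) (M : memory) : Prop :=
  match s with
  | Ins (Const d k) => Q (fun p => put (F p) d (int_word T bits k)) M
  | Ins (Pid d) => Q (fun p => put (F p) d (int_word T bits p)) M
  | Ins (Size d) => Q (fun p => put (F p) d (int_word T bits n)) M
  | Ins (Move d a) => Q (fun p => put (F p) d (reg (F p) a)) M
  | Ins (Arith o d a b) => exists x y : 'I_n -> nat,
      [/\ forall p, reg (F p) a = Int (x p), forall p, reg (F p) b = Int (y p) &
        Q (fun p => put (F p) d (int_word T bits (eval_arith o (x p) (y p)))) M]
  | Ins (Read d a) => exists x : 'I_n -> 'I_n,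
      (forall p, reg (F p) a = Int (x p)) /\
      Q (fun p => put (F p) d (M (x p))) M
  | Ins _ => False
  | Sel d x y a b => exists c : 'I_n -> bool,
      (forall p, word_le (reg (F p) x) (reg (F p) y) = Some (c p)) /\
      Q (fun p => put (F p) d (if c p then reg (F p) a else reg (F p) b)) M
  | Wr x y a b => exists (c : 'I_n -> bool) (adr : 'I_n -> 'I_n),
      [/\ forall p, word_le (reg (F p) x) (reg (F p) y) = Some (c p),
          forall p, c p -> reg (F p) a = Int (adr p) &
          forall M' : memory,
          (forall i, (exists p, [/\ c p, adr p = i & M' i = reg (F p) b]) \/
                     (forall p, c p -> adr p <> i) /\ M' i = M i) -> Q F M']
  end.

Definition wp (ss : seq (stmt r)) (Q : regfile -> memory -> Prop) :=
  foldr wp1 Q ss.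

Lemma address_ord (i : 'I_n) : address n (Int i : wrd) = Some i.
Proof. by rewrite /address valK. Qed.

Section Run.
Variables (adv : arbiter T r n) (input : n.-tuple T) (u : nat -> 'I_n -> 'I_n).
Hypothesis adv_ok : valid_arbiter code adv.
Local Notation conf t := (run code bits adv input u t).2.
Local Notation instr_at k := (nth Halt code k).

Lemma confS t : conf t.+1 =
  pram_step code bits (u t) (adv (run code bits adv input u t).1 (conf t)) (conf t).
Proof. by rewrite /=; case: (run _ _ _ _ _ _). Qed.

Lemma confS_nowrite t :
  (forall p, write_of code n (procs (conf t) p) = None) ->
  conf t.+1 = Config (fun p => proc_step code bits (cells (conf t)) (u t p) p
                                 (procs (conf t) p)) (cells (conf t)).
Proof.
move=> H; rewrite confS /pram_step; congr Config.
by apply: funext => i; rewrite H.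
Qed.

(** A valid arbiter names an actual writer of the cell if there is one; otherwise the named
    processor does not touch the cell. This dichotomy is all that is ever used about the arbiter. *)
Lemma confS_write t i (M' := cells (conf t.+1)) :
  (exists p v, write_of code n (procs (conf t) p) = Some (i, v) /\ M' i = v) \/
  (forall p v, write_of code n (procs (conf t) p) <> Some (i, v)) /\
  M' i = cells (conf t) i.
Proof.
have [[p wi]|nw] := pselect (exists p, writes_to code (procs (conf t) p) i).
- left; have := adv_ok (run code bits adv input u t).1 (ex_intro _ p wi).
  rewrite /M' confS /pram_step /=; set q := adv _ _ _; rewrite /writes_to.
  case E: write_of => [[j v]|//] /eqP ji; subst j.
  by exists q, v; rewrite eqxx.
- right; split=> [p v E|].
    by apply: nw; exists p; rewrite /writes_to E eqxx.
  rewrite /M' confS /pram_step /=; set q := adv _ _ _.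
  case E: write_of => [[j v]|//]; case: eqP => // ji; subst j.
  by case: nw; exists q; rewrite /writes_to E eqxx.
Qed.

Definition quiet (i : instr r) : bool := if i is Write _ _ then false else true.

Lemma write_of_quiet (s : processor T r) :
  quiet (fetch code s) -> @write_of _ T r code n s = None.
Proof. by rewrite /write_of; case: fetch. Qed.

Lemma conf_step t (Pc : 'I_n -> nat) (F : 'I_n -> 'I_r -> wrd) M :
  conf t = Config (fun p => Processor (Pc p) (F p)) M ->
  (forall p, quiet (instr_at (Pc p))) ->
  conf t.+1 = Config (fun p => proc_step code bits M (u t p) p
                                 (Processor (Pc p) (F p))) M.
Proof.
move=> E H; rewrite confS_nowrite ?E //= => p.
by apply: write_of_quiet; apply: H.
Qed.

Lemma exec1 s Q t l F M : conf t = aligned l F M -> code_at code l (asm l s) ->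
  wp1 s Q F M -> exists F' M',
  conf (t + duration s) = aligned (l + size (asm l s)) F' M' /\ Q F' M'.
Proof.
case: s => [i|d x y a b|x y a b] Et Cl.
- have {Cl} Ci : instr_at l = i by have := Cl 0 isT; rewrite addn0.
  rewrite /= !addn1 => W.
  have [Qi H] : quiet i /\ exists F', (forall p, proc_step code bits M (u t p) p
      (Processor l (regs_of (F p))) = Processor l.+1 (regs_of (F' p))) /\ Q F' M.
    case: i Ci W => //= [d k|d|d|d a|o d a b|d a] Ci W; split => //.
    + by eexists; split; last exact: W; move=> p; rewrite /proc_step /fetch Ci regs_of_put.
    + by eexists; split; last exact: W; move=> p; rewrite /proc_step /fetch Ci regs_of_put.
    + by eexists; split; last exact: W; move=> p; rewrite /proc_step /fetch Ci regs_of_put.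
    + by eexists; split; last exact: W; move=> p; rewrite /proc_step /fetch Ci regs_of_put.
    + case: W => x [y [Hx Hy W]]; eexists; split; last exact: W; move=> p.
      by rewrite /proc_step /fetch Ci -regs_of_put /regs_of /= Hx Hy.
    + case: W => x [Hx W]; eexists; split; last exact: W; move=> p.
      by rewrite /proc_step /fetch Ci -regs_of_put /regs_of /= Hx address_ord.
  case: H => F' [H HQ]; exists F', M; split => //.
  rewrite (conf_step Et); last by move=> p; rewrite Ci.
  by congr Config; apply: funext => p; apply: H.
- case=> c [Hc HQ]; eexists; exists M; split; last exact: HQ.
  rewrite [size _]/= [duration _]/= addn3.
  have C0 : instr_at l = JumpLe x y (l + 3) by have := Cl 0 isT; rewrite addn0.
  have C1 : instr_at (l.+1) = Move d b by have := Cl 1 isT; rewrite addn1.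
  have C2 : instr_at (l.+2) = Jump (l + 5) by have := Cl 2 isT; rewrite addn2.
  have C3 : instr_at (l + 3) = Move d a by have := Cl 3 isT.
  have C4 : instr_at ((l + 3).+1) = Jump (l + 5) by have := Cl 4 isT; rewrite addn4 addn3.
  have E1 : conf t.+1 =
      Config (fun p => Processor (if c p then l + 3 else l.+1) (regs_of (F p))) M.
    rewrite (conf_step Et); last by move=> p; rewrite C0.
    congr Config; apply: funext => p; rewrite /proc_step /fetch C0 /regs_of /= Hc.
    by case: (c p).
  have E2 : conf t.+2 =
      Config (fun p => Processor (if c p then (l + 3).+1 else l.+2)
        (regs_of (put (F p) d (if c p then reg (F p) a else reg (F p) b)))) M.
    rewrite (conf_step E1); last by move=> p; case: (c p); rewrite ?C1 ?C3.
    congr Config; apply: funext => p; rewrite /proc_step /fetch /= -regs_of_put.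
    by case: (c p); rewrite ?C1 ?C3.
  rewrite (conf_step E2); last by move=> p; case: (c p); rewrite ?C2 ?C4.
  congr Config; apply: funext => p; rewrite /proc_step /fetch /=.
  by case: (c p); rewrite ?C2 ?C4.
- case=> c [adr [Hc Ha HQ]].
  rewrite [size _]/= [duration _]/= addn3.
  have C0 : instr_at l = JumpLe x y (l + 3) by have := Cl 0 isT; rewrite addn0.
  have C1 : instr_at (l.+1) = Move a a by have := Cl 1 isT; rewrite addn1.
  have C2 : instr_at (l.+2) = Jump (l + 5) by have := Cl 2 isT; rewrite addn2.
  have C3 : instr_at (l + 3) = Write a b by have := Cl 3 isT.
  have C4 : instr_at ((l + 3).+1) = Jump (l + 5) by have := Cl 4 isT; rewrite addn4 addn3.
  have E1 : conf t.+1 =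
      Config (fun p => Processor (if c p then l + 3 else l.+1) (regs_of (F p))) M.
    rewrite (conf_step Et); last by move=> p; rewrite C0.
    congr Config; apply: funext => p; rewrite /proc_step /fetch C0 /regs_of /= Hc.
    by case: (c p).
  (* Processors with [c p] now execute the [Write]; the others spend the step on [Move a a], which
     changes nothing. *)
  have WO p : write_of code n (procs (conf t.+1) p) =
      if c p then Some (adr p, reg (F p) b) else None.
    rewrite E1 /write_of /fetch /=; case: ifP => cp; rewrite ?C1 ?C3 //.
    by rewrite /regs_of /= Ha // address_ord.
  exists F, (cells (conf t.+2)); split.
  + have E2 : conf t.+2 =
        Config (fun p => Processor (if c p then (l + 3).+1 else l.+2) (regs_of (F p)))
               (cells (conf t.+2)).
      rewrite {1}confS {1}/pram_step; congr Config; last by rewrite [in RHS]confS.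
      apply: funext => p; rewrite E1 /proc_step /fetch /=.
      case: ifP => cp; rewrite ?C1 ?C3 /=.
        by rewrite {1}/regs_of Ha // address_ord.
      by congr Processor; apply: funext => k /=; case: eqP => // ->.
    rewrite (conf_step E2); last by move=> p; case: (c p); rewrite ?C2 ?C4.
    congr Config; apply: funext => p; rewrite /proc_step /fetch /=.
    by case: (c p); rewrite ?C2 ?C4.
  + apply: HQ => i; have := confS_write t.+1 i.
    case=> [[p [v [Hp Ev]]]|[Hn Ev]]; [left|right].
    * exists p; move: Hp; rewrite WO; case: ifP => // cp [-> Eb].
      by split=> //; rewrite Ev.
    * split=> [p cp ai|]; last by rewrite Ev E1.
      by apply: (Hn p (reg (F p) b)); rewrite WO cp ai.
Qed.

Lemma exec ss Q t l F M : conf t = aligned l F M -> code_at code l (asms l ss) ->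
  wp ss Q F M -> exists F' M',
  conf (t + durations ss) = aligned (l + size (asms l ss)) F' M' /\ Q F' M'.
Proof.
elim: ss t l F M => [|s ss IH] t l F M Et /=.
  by move=> _ HQ; exists F, M; rewrite /durations /= !addn0.
case/code_at_cat => Cs Css W.
have [F' [M' [Et' W']]] := exec1 Et Cs W.
have [F2 [M2 [Et2 HQ]]] := IH _ _ _ _ Et' Css W'.
by exists F2, M2; rewrite size_cat /durations /= !addnA in Et2 *.
Qed.

(** A loop test keeps the processors aligned because its outcome [b] is the same for all of them. *)
Lemma exec_jump t l x y l' (b : bool) F M : conf t = aligned l F M ->
  instr_at l = JumpLe x y l' ->
  (forall p, word_le (reg (F p) x) (reg (F p) y) = Some b) ->
  conf t.+1 = aligned (if b then l' else l.+1) F M.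
Proof.
move=> Et Cl H; rewrite (conf_step Et); last by move=> p; rewrite Cl.
congr Config; apply: funext => p.
by rewrite /proc_step /fetch Cl /regs_of /= H; case: (b).
Qed.

Lemma conf_halted t k l F M : conf t = aligned l F M -> instr_at l = Halt ->
  conf (t + k) = aligned l F M.
Proof.
move=> Et Cl; elim: k => [|k IH]; first by rewrite addn0.
rewrite addnS (conf_step IH); last by move=> p; rewrite Cl.
by congr Config; apply: funext => p; rewrite /proc_step /fetch Cl.
Qed.

End Run.
End Lockstep.
Arguments aligned {disp T r n}.
Arguments wp : simpl never.

(** * Insertion rounds *)

(* A draw [a] lies below the threshold [2 ^ j] iff [lev a <= j]. *)
Definition lev (a : nat) : nat := up_log 2 a.+1.

Lemma lev_le a k : (lev a <= k) = (a < 2 ^ k).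
Proof.
apply/idP/idP => [H|]; last by exact: up_log_min.
by apply: leq_trans (up_logP _ _) (leq_pexp2l _ H).
Qed.

Section Rounds.
Variables (n' : nat).
Local Notation n := n'.+1.
Variables (lt : rel 'I_n) (u : 'I_n -> nat).
Hypotheses (lt_irr : irreflexive lt) (lt_trans : transitive lt).
Hypothesis lt_total : forall x y, x != y -> lt x y || lt y x.
Hypothesis u_lt : forall x, u x < n.

(* [gap] and [thr] are meaningful for unplaced processors only, [nxt] for placed
   ones; the list is circular, so that [nxt] of the last element is [ord0]. *)
Record state := State {
  unplaced : 'I_n -> bool;
  gap : 'I_n -> 'I_n;
  thr : 'I_n -> nat;
  nxt : 'I_n -> 'I_n
}.

(* As a gap, [ord0] stands for minus infinity rather than for its own element. *)
Definition above (v y : 'I_n) : bool := (v == ord0) || lt v y.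

Definition cand (S : state) (v x : 'I_n) : bool :=
  [&& unplaced S x, gap S x == v & u x < thr S x].

(** [win v] is the processor whose claim on the cell of [v] succeeded. Leaving it arbitrary among
    the candidates covers every resolution of conflicts. *)
Definition ins_round (win : 'I_n -> option 'I_n) (S S' : state) : Prop :=
  [/\ forall v w, win v = Some w -> cand S v w,
      forall v x, win v = None -> ~~ cand S v x &
      forall x,
        if unplaced S x then
          if win (gap S x) is Some w then
            if w == x then unplaced S' x = false /\ nxt S' x = nxt S (gap S x)
            else [/\ unplaced S' x = true, gap S' x = (if lt w x then w else gap S x)
                   & thr S' x = thr S x]
          else [/\ unplaced S' x = true, gap S' x = gap S x & thr S' x = thr S x + thr S x]
        else unplaced S' x = false /\ nxt S' x = odflt (nxt S x) (win x)].

Definition between (x z w : 'I_n) : bool := lt x z && lt z w || lt w z && lt z x.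

Definition rivals (x : 'I_n) : {set 'I_n} :=
  [set w | [&& w != ord0, w != x &
    [forall z, (z != ord0) && between x z w ==> (lev (u w) <= lev (u z))]]].

(* [inv_time]: in each round survived by [x] either the threshold of [x] doubles
   or another rival of [x] is placed. *)
Record list_inv (k : nat) (S : state) : Prop := Inv {
  inv0 : unplaced S ord0 = false;
  inv_gap : forall x, unplaced S x -> [/\ unplaced S (gap S x) = false, above (gap S x) x &
    forall y, unplaced S y = false -> y != ord0 -> above (gap S x) y -> ~~ lt y x];
  inv_thr : forall x y, unplaced S x -> unplaced S y -> gap S x = gap S y -> thr S x = thr S y;
  inv_time : forall x, unplaced S x -> exists j, [/\ thr S x = 2 ^ j,
    j = 0 \/ 2 ^ j <= 2 * u x &
    k <= j + #|[set y in rivals x | ~~ unplaced S y]|];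
  inv_nxt : forall v, unplaced S v = false -> [/\ unplaced S (nxt S v) = false,
    nxt S v = ord0 \/ above v (nxt S v) &
    forall y, unplaced S y = false -> y != ord0 -> above v y ->
      nxt S v != ord0 /\ ~~ lt y (nxt S v)]
}.

Lemma nlt_asym x y : lt x y -> ~~ lt y x.
Proof. by move=> xy; apply/negP => yx; have := lt_trans xy yx; rewrite lt_irr. Qed.

Lemma above_trans v x y : above v x -> lt x y -> above v y.
Proof. by rewrite /above => /orP[->//|vx] xy; rewrite (lt_trans vx xy) orbT. Qed.

(** * Preservation of the list invariant by a round *)

Section Step.
Variables (k : nat) (S S' : state) (win : 'I_n -> option 'I_n).
Hypotheses (I : list_inv k S) (Rd : ins_round win S S').

Lemma un_neq0 x : unplaced S x -> x != ord0.
Proof. by apply: contraTneq => ->; rewrite (inv0 I). Qed.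

Lemma placed_neq x y : unplaced S x -> unplaced S y = false -> x != y.
Proof. by move=> ux uy; apply: contraTneq ux => ->; rewrite uy. Qed.

Lemma win_cand v w : win v = Some w -> [/\ unplaced S w, gap S w = v & u w < thr S w].
Proof. by case: Rd => H _ _ /H /and3P[? /eqP]. Qed.

Lemma un_mono x : unplaced S' x -> unplaced S x.
Proof.
by case: Rd => _ _ /(_ x); case: (unplaced S x) => // -[->].
Qed.

Lemma placed_mono x : unplaced S x = false -> unplaced S' x = false.
Proof. by move=> ux; apply/negbTE; apply/negP => /un_mono; rewrite ux. Qed.

Lemma new_win y : unplaced S y -> unplaced S' y = false -> win (gap S y) = Some y.
Proof.
case: Rd => _ _ /(_ y) + uy; rewrite uy; case: (win _) => [w|[->]//].
by case: eqVneq => [-> //|_ [->]].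
Qed.

Lemma win_new v w : win v = Some w -> unplaced S' w = false.
Proof.
move=> E; have [uw gw _] := win_cand E.
by case: Rd => _ _ /(_ w); rewrite uw gw E eqxx => -[].
Qed.

(** If the gaps differed, the larger would be a placed processor between the smaller one and the
    processor waiting there, against the maximality of that gap. *)
Lemma gap_lt_eq x y : unplaced S x -> unplaced S y -> above (gap S x) y -> lt y x ->
  gap S y = gap S x.
Proof.
move=> ux uy ay yx.
have [px ax mx] := inv_gap I ux; have [py ay' my] := inv_gap I uy.
have yn : gap S y != ord0 -> lt (gap S y) y.
  by move=> h; move: ay'; rewrite /above (negbTE h).
case: (eqVneq (gap S y) ord0) => [y0|y0].
  case: (eqVneq (gap S x) ord0) => [->//|x0].
  have /negP[] := my (gap S x) px x0 ltac:(by rewrite y0 /above eqxx).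
  by move: ay; rewrite /above (negbTE x0).
have lyy := yn y0.
have nax : ~~ above (gap S x) (gap S y).
  by apply/negP => /(mx _ py y0); rewrite (lt_trans lyy yx).
move: nax; rewrite /above negb_or => /andP[x0 nl].
have lxy : lt (gap S x) y by move: ay; rewrite /above (negbTE x0).
have nl2 : ~~ lt (gap S y) (gap S x).
  by apply/negP => h; have := my _ px x0; rewrite /above h orbT lxy => /(_ isT).
case: (eqVneq (gap S y) (gap S x)) => // /lt_total.
by rewrite (negbTE nl) (negbTE nl2).
Qed.

(** A processor [z] between [x] and the winner [w] is unplaced and in the same gap, so it has the
    same threshold [2 ^ j]. Unless [j = 0], its draw is not below half of that, so its level is at
    least [j], while that of [w] is at most [j]. *)
Lemma win_rivals x w : unplaced S x -> win (gap S x) = Some w -> w != x -> w \in rivals x.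
Proof.
move=> ux E wx; have [uw gw tw] := win_cand E.
rewrite inE un_neq0 // wx; apply/forallP => z; apply/implyP => /andP[z0 bz].
have [px ax mx] := inv_gap I ux; have [pw aw mw] := inv_gap I uw.
rewrite gw in pw aw mw.
have [uz gz] : unplaced S z /\ gap S z = gap S x.
  case/orP: bz => /andP[h1 h2].
  - have az : above (gap S x) z by apply: above_trans ax h1.
    have uz : unplaced S z by apply: contraT => /negbTE /mw /(_ z0 az); rewrite h2.
    by split=> //; rewrite -gw; apply: gap_lt_eq; rewrite ?gw.
  - have az : above (gap S x) z by apply: above_trans aw h1.
    have uz : unplaced S z by apply: contraT => /negbTE /mx /(_ z0 az); rewrite h2.
    by split=> //; apply: gap_lt_eq.
have tz : thr S z = thr S w by apply: (inv_thr I); rewrite ?gw.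
have [j [ej hj _]] := inv_time I uz.
have wj : lev (u w) <= j by rewrite lev_le -ej tz.
apply: leq_trans wj _; case: hj => [->//|hj].
case: j hj {ej} => // j; rewrite expnS leq_pmul2l // => hj.
by rewrite ltnNge lev_le -leqNgt.
Qed.

(** A processor placed between the old gap and [x] must be the unique winner of that gap, and this
    winner becomes the new gap whenever it lies below [x]. *)
Lemma round_gap x : unplaced S' x -> [/\ unplaced S' (gap S' x) = false, above (gap S' x) x &
    forall y, unplaced S' y = false -> y != ord0 -> above (gap S' x) y -> ~~ lt y x].
Proof.
move=> ux'; have ux := un_mono ux'; have [px ax mx] := inv_gap I ux.
have new y : unplaced S' y = false -> y != ord0 -> above (gap S x) y -> lt y x ->
    win (gap S x) = Some y.
  move=> uy y0 ay yx; case uy' : (unplaced S y); last by have := mx y uy' y0 ay; rewrite yx.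
  by rewrite -(gap_lt_eq ux uy' ay yx) new_win.
case: (Rd) => _ _ /(_ x); rewrite ux; case E : (win _) => [w|]; last first.
  case=> _ -> _; split=> [| //|y uy y0 ay]; first exact: placed_mono.
  by apply/negP => yx; have := new y uy y0 ay yx; rewrite E.
have [uw gw _] := win_cand E.
case: eqVneq => [_ [h]|wx [_ -> _]]; first by rewrite h in ux'.
case: ifP => [lwx|nlwx].
- split=> [| |y uy y0 ay]; [exact: win_new E|by rewrite /above lwx orbT|].
  apply/negP => yx.
  have lwy : lt w y by move: ay; rewrite /above (negbTE (un_neq0 uw)).
  have [_ aw _] := inv_gap I uw; rewrite gw in aw.
  have := new y uy y0 (above_trans aw lwy) yx; rewrite E => -[wy].
  by rewrite wy lt_irr in lwy.
- split=> [| //|y uy y0 ay]; first exact: placed_mono.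
  by apply/negP => yx; have := new y uy y0 ay yx; rewrite E => -[wy]; rewrite wy yx in nlwx.
Qed.

Lemma round_thr x y : unplaced S' x -> unplaced S' y -> gap S' x = gap S' y -> thr S' x = thr S' y.
Proof.
move=> ux' uy' gxy; have ux := un_mono ux'; have uy := un_mono uy'.
suff g : gap S x = gap S y.
  have t := inv_thr I ux uy g.
  case: (Rd) => _ _ H; have := H x; have := H y; rewrite ux uy g.
  case: (win _) => [w|[_ _ -> [_ _ ->]]]; last by rewrite t.
  case: eqVneq => [_ [h]|_ [_ _ ->]]; first by rewrite h in uy'.
  by case: eqVneq => [_ [h]|_ [_ _ ->//]]; rewrite h in ux'.
(* A changed gap was unplaced before the round, an unchanged one was placed; so equal new gaps come
   from equal old ones. *)
have old z : unplaced S' z -> gap S' z = gap S z \/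
    exists w, [/\ win (gap S z) = Some w, gap S' z = w & unplaced S w].
  move=> uz'; have uz := un_mono uz'.
  case: (Rd) => _ _ /(_ z); rewrite uz; case E: (win _) => [w|]; last by case=> _ -> _; left.
  have [uw _ _] := win_cand E.
  case: eqVneq => [_ [h]|_ [_ -> _]]; first by rewrite h in uz'.
  by case: ifP => _; [right; exists w|left].
have [px _ _] := inv_gap I ux; have [py _ _] := inv_gap I uy.
have [ex|[w [Ew ew uw]]] := old x ux'; have [ey|[v [Ev ev uv]]] := old y uy'.
- by rewrite -ex -ey.
- by rewrite -ex gxy ev uv in px.
- by rewrite -ey -gxy ew uw in py.
- have [_ <- _] := win_cand Ew; have [_ <- _] := win_cand Ev.
  by rewrite -ew -ev gxy.
Qed.

(** If another processor wins, it is a rival not counted before. If nobody wins, [x] was no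
    candidate, so its draw is at least the old threshold, half of the new one. *)
Lemma round_time x : unplaced S' x -> exists j, [/\ thr S' x = 2 ^ j,
    j = 0 \/ 2 ^ j <= 2 * u x & k < j + #|[set y in rivals x | ~~ unplaced S' y]|].
Proof.
move=> ux'; have ux := un_mono ux'; have [j [ej hj kj]] := inv_time I ux.
have sub : [set y in rivals x | ~~ unplaced S y] \subset [set y in rivals x | ~~ unplaced S' y].
  apply/fintype.subsetP => y; rewrite !finset.in_set => /andP[-> /negbTE /placed_mono ->].
  by [].
case: (Rd) => _ /(_ (gap S x) x) Hn /(_ x); rewrite ux; case E : (win _) => [w|].
- case: eqVneq => [_ [h]|wx [_ _ ->]]; first by rewrite h in ux'.
  exists j; split=> //; apply: leq_ltn_trans kj _; rewrite ltn_add2l.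
  apply: proper_card; rewrite properE sub; apply/fintype.subsetPn; exists w.
    by rewrite finset.in_set (win_rivals ux E wx) (win_new E).
  by rewrite finset.in_set; have [-> _ _] := win_cand E; rewrite andbF.
- case=> _ _ ->; exists j.+1; rewrite ej addnn expnS mul2n; split=> //.
    right; rewrite -mul2n leq_pmul2l // leqNgt -ej; apply: contra (Hn E) => h.
    by rewrite /cand ux eqxx.
  by apply: leq_ltn_trans kj _; rewrite addSn ltnS leq_add2l subset_leq_card.
Qed.

(** The gap of [y] is itself a placed processor above [v], hence not before the successor of [v],
    and [y] lies beyond it. *)
Lemma new_beyond v y : unplaced S v = false -> unplaced S y -> unplaced S' y = false ->
  above v y -> gap S y <> v -> nxt S v != ord0 /\ ~~ lt y (nxt S v).
Proof.
move=> pv uy uy' vy gv; have [pg ag mg] := inv_gap I uy.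
have [_ _ H] := inv_nxt I pv.
have [g0 vg] : gap S y != ord0 /\ above v (gap S y).
  move: vy; rewrite /above; case: (eqVneq v ord0) => [v0 _|v0 /= lvy].
    by split=> //; apply/eqP => g0; apply: gv; rewrite g0.
  have : ~~ above (gap S y) v by apply/negP => /(mg _ pv v0); rewrite lvy.
  rewrite /above negb_or => /andP[-> nl]; split=> //.
  have /lt_total : gap S y != v by apply/eqP.
  by rewrite (negbTE nl).
have lgy : lt (gap S y) y by move: ag; rewrite /above (negbTE g0).
have [-> nl] := H _ pg g0 vg; split=> //.
by apply: contra nl => /(lt_trans lgy).
Qed.

(** A new node takes over the successor of its gap, and the gap then points to the new node. By
    [new_beyond], insertions into other gaps do not disturb these links. *)
Lemma round_nxt v : unplaced S' v = false -> [/\ unplaced S' (nxt S' v) = false,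
    nxt S' v = ord0 \/ above v (nxt S' v) &
    forall y, unplaced S' y = false -> y != ord0 -> above v y ->
      nxt S' v != ord0 /\ ~~ lt y (nxt S' v)].
Proof.
move=> pv'; case: (Rd) => _ _ /(_ v); case uv: (unplaced S v).
- have E := new_win uv pv'; rewrite E eqxx => -[_ ->].
  have [pg ag mg] := inv_gap I uv; have [pn an mn] := inv_nxt I pg.
  have v0 := un_neq0 uv.
  split; first exact: placed_mono.
    case: (eqVneq (nxt S (gap S v)) ord0) => [->|n0]; [by left|right].
    case: an => [an|an]; first by rewrite an eqxx in n0.
    have := mg _ pn n0 an; have := lt_total (placed_neq uv pn).
    by rewrite /above => /orP[->|->//]; rewrite orbT.
  move=> y py' y0 ay.
  have lvy : lt v y by move: ay; rewrite /above (negbTE v0).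
  have agy := above_trans ag lvy.
  case uy : (unplaced S y); last exact: mn.
  apply: new_beyond => // gy.
  by have := new_win uy py'; rewrite gy E => -[vy]; rewrite vy lt_irr in lvy.
- have [pn an mn] := inv_nxt I uv.
  case E : (win v) => [w|] /= [_ ->].
  + have [uw gw _] := win_cand E; have [pg ag mg] := inv_gap I uw.
    rewrite gw in pg ag mg; split; [exact: win_new E|by right|].
    move=> y py' y0 ay; split; first exact: un_neq0.
    case uy : (unplaced S y); last exact: mg.
    apply/negP => yw; have gy := gap_lt_eq uw uy; rewrite gw in gy.
    have := new_win uy py'; rewrite (gy ay yw) E => -[wy].
    by rewrite wy lt_irr in yw.
  + split=> //; first exact: placed_mono.
    move=> y py' y0 ay; case uy : (unplaced S y); last exact: mn.
    by apply: new_beyond => // gy; have := new_win uy py'; rewrite gy E.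
Qed.

Lemma round_inv : list_inv k.+1 S'.
Proof.
split; [exact: placed_mono (inv0 I)|exact: round_gap|exact: round_thr|
        exact: round_time|exact: round_nxt].
Qed.

End Step.

Definition start_state : state := State (fun x => x != ord0) (fun=> ord0) (fun=> 1) (fun=> ord0).

Lemma inv_init : list_inv 0 start_state.
Proof.
split=> //=.
- by move=> x _; split=> // y /negbFE ->.
- by move=> x _; exists 0; split=> //; left.
- move=> v /negbFE /eqP ->; split=> //; first by left.
  by move=> y /negbFE ->.
Qed.

Definition slowest : nat := \max_x #|rivals x|.

(** The threshold of an unplaced [x] has doubled at most [up_log 2 n] times, since it is 1 or at
    most twice a draw below [n]; each other round is paid for by a rival. *)
Lemma inv_bound k S x : list_inv k S -> unplaced S x -> k <= up_log 2 n + slowest.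
Proof.
move=> I ux; have [j [_ hj kj]] := inv_time I ux.
apply: leq_trans kj _; apply: leq_add.
- case: hj => [->//|hj]; rewrite -ltnS -(ltn_exp2l _ _ (isT : 1 < 2)).
  apply: leq_ltn_trans hj _; rewrite expnS ltn_pmul2l //.
  by apply: leq_trans (u_lt x) (up_logP _ _).
- apply: leq_trans (leq_bigmax x); apply/subset_leq_card/fintype.subsetP => y.
  by rewrite finset.in_set => /andP[].
Qed.

Lemma slowest_le : slowest <= n.
Proof. by apply/bigmax_leqP => x _; rewrite -[X in _ <= X]card_ord max_card. Qed.

(* The number of list nodes from [x] on, not counting the head [ord0]. *)
Definition tail (x : 'I_n) : nat :=
  if x == ord0 then 0 else #|[set y | (y != ord0) && ~~ lt y x]|.

(** No node lies strictly between [x] and its successor, so moving on drops exactly [x]. At the last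
    node both sides are 0. *)
Lemma tail_nxt k S x : list_inv k S -> (forall x, unplaced S x = false) -> x != ord0 ->
  tail (nxt S x) = (tail x).-1.
Proof.
move=> I pl x0.
have [_ nx mx] := inv_nxt I (pl x).
rewrite /tail (negbTE x0).
have xin : x \in [set y | (y != ord0) && ~~ lt y x] by rewrite finset.in_set x0 lt_irr.
rewrite [in RHS](cardsD1 x) xin add1n /=.
case: (eqVneq (nxt S x) ord0) => n0.
  apply/esym/eqP; rewrite cards_eq0; apply/eqP/setP => y; rewrite !inE.
  apply/negbTE/negP => /and3P[yx y0 nyx].
  have := lt_total yx; rewrite (negbTE nyx) /= => xy.
  by have [] := mx y (pl y) y0 ltac:(by rewrite /above xy orbT); rewrite n0.
case: nx => [e|]; first by rewrite e eqxx in n0.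
rewrite /above (negbTE x0) /= => xn.
congr (#|pred_of_set _|); apply/setP => y; rewrite !inE; case: (eqVneq y ord0) => y0 /=.
  by rewrite andbF.
apply/idP/idP => [nyn|/andP[yx nyx]].
  apply/andP; split; first by apply: contraNneq nyn => ->.
  by apply: contra nyn => yx; apply: lt_trans yx xn.
have := lt_total yx; rewrite (negbTE nyx) /= => xy.
by have [] := mx y (pl y) y0 ltac:(by rewrite /above xy orbT).
Qed.

Definition rank_of (x : 'I_n) : nat := #|[set y | lt y x]|.

(** The processors not below [x] are those of the tail and, if [x] lies below [ord0], also
    [ord0]. *)
Lemma rank_of_tail x : x != ord0 -> rank_of x + lt x ord0 + tail x = n.
Proof.
move=> x0; rewrite /tail (negbTE x0) /rank_of -[RHS]card_ord.
rewrite -(cardsC [set y | lt y x]) -addnA; congr (_ + _).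
rewrite [RHS](cardsD1 ord0) !inE; congr (_ + _).
  case E : (lt x ord0); first by rewrite (negbTE (nlt_asym E)).
  by have := lt_total x0; rewrite E /= => ->.
by congr (#|pred_of_set _|); apply/setP => y; rewrite !inE.
Qed.

Lemma rank_of_lt x y : lt x y -> rank_of x < rank_of y.
Proof.
move=> xy; apply: proper_card; rewrite properE; apply/andP; split.
  by apply/fintype.subsetP => z; rewrite !inE => /lt_trans; apply.
by apply/fintype.subsetPn; exists x; rewrite finset.in_set ?lt_irr.
Qed.

Lemma rank_of_ltn x : rank_of x < n.
Proof.
rewrite -[X in _ < X]card_ord -cardsT; apply: proper_card.
rewrite properE finset.subsetT; apply/fintype.subsetPn; exists x; by rewrite finset.in_set ?lt_irr.
Qed.

Lemma rank_of_inj : injective rank_of.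
Proof.
move=> x y e; apply/eqP/negPn/negP => /lt_total /orP[] /rank_of_lt; by rewrite e ltnn.
Qed.

End Rounds.

(** * Weak prefix minima of random levels *)

(** Counts the weak prefix minima of the levels along the list, ignoring entries whose level exceeds
    the starting bound [m]. *)
Fixpoint records (m : nat) (l : seq nat) : nat :=
  if l is a :: l' then
    if lev a <= m then (records (lev a) l').+1 else records m l'
  else 0.

Lemma records_ge (I : finType) (r : rel I) (f : I -> nat) m s : pairwise r s ->
  #|[set w in s | (lev (f w) <= m) &&
      all (fun z => r z w ==> (lev (f w) <= lev (f z))) s]| <= records m (map f s).
Proof.
elim: s m => [|x s IH] m /=.
  by move=> _; rewrite leqn0 cards_eq0; apply/eqP/setP => w; rewrite !inE.
case/andP=> /allP rx rs; case: (leqP (lev (f x)) m) => xm.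
- apply: leq_trans (_ : #|x |: [set w in s | (lev (f w) <= lev (f x)) &&
      all (fun z => r z w ==> (lev (f w) <= lev (f z))) s]| <= _).
    apply/subset_leq_card/fintype.subsetP => w; rewrite !inE.
    case/andP=> /orP[-> //|ws] /and3P[_ /implyP/(_ (rx _ ws)) h1 h2].
    by rewrite ws h1 h2 orbT.
  by apply: leq_trans (leq_card_setU _ _) _; rewrite cards1 add1n ltnS IH.
- apply: leq_trans (IH m rs); apply/subset_leq_card/fintype.subsetP => w; rewrite !inE.
  case/andP=> /orP[/eqP ->|ws] /and3P[h _ h2]; first by rewrite leqNgt xm in h.
  by rewrite ws h h2.
Qed.

(** Level 0 has one value and level [j > 0] has [2 ^ (j - 1)], so equality holds at [K = 2 ^ m]; the
    [+ 1] stems from the atom at level 0. *)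
Lemma lev_sum m K : K <= 2 ^ m -> 3 * (\sum_(0 <= a < K) 2 ^ lev a) <= 2 * K * 2 ^ m + 1.
Proof.
elim: m K => [|m IH] K.
  rewrite expn0; case: K => [|[|//]] _; first by rewrite big_nil.
  by rewrite big_nat1 /lev up_log1.
move=> HK; have E : 2 ^ m.+1 = 2 * 2 ^ m by rewrite expnS.
case: (leqP K (2 ^ m)) => [/IH|Km]; first by rewrite E; nia.
rewrite (big_cat_nat (n := 2 ^ m)) //=; last exact: ltnW.
have := IH _ (leqnn _).
have : \sum_(2 ^ m <= a < K) 2 ^ lev a <= (K - 2 ^ m) * 2 ^ m.+1.
  rewrite -sum_nat_const_nat; rewrite big_nat_cond [leqRHS]big_nat_cond.
  apply: leq_sum => a /andP[/andP[_ aK] _]; rewrite leq_exp2l // lev_le.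
  exact: leq_trans aK HK.
rewrite E; move: HK; rewrite E; nia.
Qed.

(** One step of the potential [2 ^ m]: a record [a] trades it for [3 / 2] times [2 ^ lev a], and on
    average it grows by at most [1 / (2 * n)]. The inequality is multiplied by [2 * n]. *)
Lemma lev_mix m n : \sum_(a < n) (if lev a <= m then 3 * 2 ^ lev a else 2 * 2 ^ m)
  <= 2 * n * 2 ^ m + 1.
Proof.
rewrite -(big_mkord xpredT (fun a => if lev a <= m then 3 * 2 ^ lev a else 2 * 2 ^ m)).
have H K : K <= 2 ^ m ->
    \sum_(0 <= a < K) (if lev a <= m then 3 * 2 ^ lev a else 2 * 2 ^ m) <=
    2 * K * 2 ^ m + 1.
  move=> HK; apply: leq_trans (lev_sum HK); rewrite big_distrr /= leq_eqVlt.
  apply/orP; left; apply/eqP; rewrite big_nat_cond [RHS]big_nat_cond.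
  apply: eq_bigr => a /andP[/andP[_ aK] _].
  by rewrite lev_le (leq_trans aK HK).
case: (leqP n (2 ^ m)) => [/H //|nm].
rewrite (big_cat_nat (n := 2 ^ m)) //=; last exact: ltnW.
have := H _ (leqnn _).
have -> : \sum_(2 ^ m <= a < n) (if lev a <= m then 3 * 2 ^ lev a else 2 * 2 ^ m) =
    (n - 2 ^ m) * (2 * 2 ^ m).
  rewrite -sum_nat_const_nat; rewrite big_nat_cond [RHS]big_nat_cond.
  by apply: eq_bigr => a /andP[/andP[am _] _]; rewrite lev_le ltnNge am.
nia.
Qed.


(** * Exponential moment and tail of the number of records *)

Section Resample.
Local Open Scope ring_scope.
Variables (V : nmodType) (I A : finType) (x : I) (s : seq I) (H : A -> seq A -> V).
Hypothesis xs : x \notin s.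

Let upd (p : {ffun I -> A} * A) : {ffun I -> A} * A :=
  ([ffun y => if y == x then p.2 else p.1 y], p.1 x).

(** The value at [x] is independent of those on [s]: exchanging it with a fresh [a] is an involution
    on pairs that leaves the values on [s] alone. *)
Lemma sum_resample : (\sum_(f : {ffun I -> A}) H (f x) (map f s)) *+ #|A| =
  \sum_(a : A) \sum_(f : {ffun I -> A}) H a (map f s).
Proof.
have updK : involutive upd.
  move=> [f a]; rewrite /upd /= ffunE eqxx; congr pair; apply/ffunP => y.
  by rewrite !ffunE; case: eqP => // ->.
rewrite exchange_big pair_bigA /= (reindex_inj (inv_inj updK)) /=.
rewrite -sumrMnl -(pair_bigA _ (fun (f : {ffun I -> A}) (a : A) =>
  H (f x) (map [ffun y => if y == x then a else f y] s))) /=.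
apply: eq_bigr => f _; rewrite -sumr_const; apply: eq_bigr => a _.
congr H; apply/eq_in_map => y ys; rewrite ffunE; case: eqP => // yx.
by move: ys; rewrite yx (negbTE xs).
Qed.

End Resample.

Section Moment.
Local Open Scope ring_scope.
Variables (R : realFieldType) (I : finType) (n : nat).
Hypothesis n_gt0 : (0 < n)%N.
Local Notation F := {ffun I -> 'I_n}.
(* Below level 0 there is no smaller level to end the sequence of records, hence
   the extra factor for each element. *)
Local Notation rho := (1 + (2 * n%:R)^-1 : R).
Local Notation vals f s := [seq nat_of_ord (f y) | y <- s].

(** By induction, resampling the first entry and applying [lev_mix]. Since [2 ^ m] is at least 1,
    the error of [1 / (2 * n)] is absorbed by one factor [rho]. *)
Lemma records_moment m (s : seq I) : uniq s ->
  \sum_(f : F) (3 / 2 : R) ^+ records m (vals f s) <=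
  #|{: F}|%:R * (2 ^+ m * rho ^+ size s).
Proof.
have rho1 : 1 <= rho by rewrite lerDl invr_ge0 mulr_ge0.
elim: s m => [|x s IH] m /=.
  by move=> _; rewrite sumr_const !expr0 mulr1 ler_peMr // exprn_ege1 // ler1n.
case/andP=> xs us.
pose H (a : 'I_n) (l : seq 'I_n) : R := (3 / 2) ^+ records m (map val (a :: l)).
have n0 : 0 < n%:R :> R by rewrite ltr0n.
rewrite -(ler_pM2r n0) [leLHS]mulr_natr.
have -> : \sum_(f : F) (3 / 2 : R) ^+ (if (lev (f x) <= m)%N
    then (records (lev (f x)) (vals f s)).+1 else records m (vals f s)) =
    \sum_(f : F) H (f x) (map f s).
  by apply: eq_bigr => f _; rewrite /H /= -map_comp.
have := sum_resample H xs; rewrite card_ord => ->.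
apply: le_trans (_ : \sum_(a < n) #|{: F}|%:R * rho ^+ size s / 2 *
  (if (lev a <= m)%N then 3 * 2 ^ lev a else 2 * 2 ^ m)%N%:R <= _).
  apply: ler_sum => a _; rewrite /H /=.
  case: ifP => am.
  - under eq_bigr do rewrite exprS -map_comp.
    rewrite -mulr_sumr natrM natrX.
    apply: le_trans (ler_wpM2l _ (IH (lev a) us)) _; first by lra.
    by rewrite le_eqVlt; apply/orP; left; apply/eqP; field.
  - under eq_bigr do rewrite -map_comp.
    rewrite natrM natrX; apply: le_trans (IH m us) _.
    by rewrite le_eqVlt; apply/orP; left; apply/eqP; field.
rewrite -mulr_sumr -natr_sum.
have := lev_mix m n; rewrite -(ler_nat R) natrD !natrM natrX => h.
apply: le_trans (ler_wpM2l _ h) _.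
  by rewrite !mulr_ge0 ?invr_ge0 // exprn_ge0 // (le_trans _ rho1).
rewrite exprS.
have -> : #|{: F}|%:R * (2 ^+ m * (rho * rho ^+ size s)) * n%:R =
   #|{: F}|%:R * rho ^+ size s / 2 * (2 * n%:R * 2 ^+ m + 2 ^+ m).
  by field; rewrite lt0r_neq0.
apply: ler_wpM2l.
  by rewrite !mulr_ge0 ?invr_ge0 // exprn_ge0 // (le_trans _ rho1).
by rewrite lerD2l exprn_ege1 // ler1n.
Qed.

Lemma rho_exp k : (k <= n)%N -> rho ^+ k <= 2.
Proof.
have n0 : 0 < n%:R :> R by rewrite ltr0n.
(* The linear bound passes through the induction because [k / n <= 1] makes the increment
   [(1 + k / n) / (2 * n)] at most [1 / n]. *)
suff H : (k <= n)%N -> rho ^+ k <= 1 + k%:R / n%:R.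
  move=> kn; apply: le_trans (H kn) _.
  have : k%:R / n%:R <= 1 :> R by rewrite ler_pdivrMr // mul1r ler_nat.
  lra.
elim: k => [|k IH] kn; first by rewrite mul0r addr0.
rewrite exprSr; apply: le_trans (ler_wpM2r _ (IH (ltnW kn))) _.
  by rewrite addr_ge0 // invr_ge0 mulr_ge0.
have -> : k.+1%:R / n%:R = k%:R / n%:R + n%:R^-1 :> R by rewrite -natr1 mulrDl div1r.
have : k%:R / n%:R <= 1 :> R by rewrite ler_pdivrMr // mul1r ler_nat ltnW.
have i0 : 0 < (n%:R : R)^-1 by rewrite invr_gt0.
rewrite invfM; set y := k%:R / n%:R => y1.
have : 0 <= y by rewrite divr_ge0.
nra.
Qed.

(** Markov's inequality for the exponential moment. *)
Lemma records_tail m t (s : seq I) : uniq s -> (size s <= n)%N ->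
  #|[set f : F | (t <= records m (vals f s))%N]|%:R * (3 / 2 : R) ^+ t <=
  #|{: F}|%:R * 2 ^+ m.+1.
Proof.
move=> us sn.
apply: le_trans (_ : #|{: F}|%:R * (2 ^+ m * rho ^+ size s) <= _); last first.
  by rewrite ler_wpM2l // exprSr ler_wpM2l ?exprn_ge0 // rho_exp.
apply: le_trans (records_moment m us).
rewrite (bigID [pred f : F | f \in [set f : F | (t <= records m (vals f s))%N]]) /=.
rewrite -[leLHS]addr0; apply: lerD; last by apply: sumr_ge0 => f _; apply: exprn_ge0; lra.
rewrite mulr_natl -sumr_const; apply: ler_sum => f; rewrite inE => h.
by apply: ler_weXn2l => //; lra.
Qed.

End Moment.

(** * Records on the two sides of a processor *)

Section Side.
Variables (n' : nat).
Local Notation n := n'.+1.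
Variables (lt : rel 'I_n).
Hypotheses (lt_irr : irreflexive lt) (lt_trans : transitive lt).
Hypothesis lt_total : forall x y, x != y -> lt x y || lt y x.

(** Listed outwards from [x]; the reversed order gives the other side. *)
Definition beyond (x : 'I_n) : seq 'I_n :=
  sort [rel y z | (y == z) || lt y z]
    [seq y <- enum 'I_n | (y != ord0) && lt x y].

Lemma mem_beyond x y : (y \in beyond x) = (y != ord0) && lt x y.
Proof. by rewrite mem_sort mem_filter mem_enum andbT. Qed.

Lemma uniq_beyond x : uniq (beyond x).
Proof. by rewrite sort_uniq filter_uniq // enum_uniq. Qed.

Lemma size_beyond x : size (beyond x) <= n.
Proof.
by rewrite size_sort size_filter (leq_trans (count_size _ _)) // size_enum_ord.
Qed.

Lemma pairwise_beyond x : pairwise lt (beyond x).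
Proof.
have le_trans : transitive [rel y z | (y == z) || lt y z].
  move=> y z w /= /orP[/eqP -> //|zy] /orP[/eqP <-|yw]; first by rewrite zy orbT.
  by rewrite (lt_trans zy yw) orbT.
have le_total : total [rel y z | (y == z) || lt y z].
  by move=> y z /=; rewrite [z == y]eq_sym; case: eqVneq => //= /lt_total.
have : pairwise [rel y z | [rel y z | (y == z) || lt y z] y z && [rel y z | y != z] y z]
    (beyond x).
  rewrite pairwise_relI -uniq_pairwise uniq_beyond andbT -(sorted_pairwise le_trans).
  exact: sort_sorted.
by apply: sub_pairwise => y z /= /andP[/orP[->|]].
Qed.

End Side.

Section Slow.
Variables (n' : nat).
Local Notation n := n'.+1.
Variables (lt : rel 'I_n).
Hypotheses (lt_irr : irreflexive lt) (lt_trans : transitive lt).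
Hypothesis lt_total : forall x y, x != y -> lt x y || lt y x.
Local Notation gt := (fun x y => lt y x).
Local Notation F := {ffun 'I_n -> 'I_n}.
Local Notation L := (up_log 2 n).

(** On its side of [x], a rival is a weak prefix minimum of the levels read outwards. The starting
    bound [L] excludes nothing, as all draws are below [n]. *)
Lemma rivals_le (u : 'I_n -> nat) x : (forall y, u y < n) ->
  #|rivals lt u x| <= records L (map u (beyond lt x)) + records L (map u (beyond gt x)).
Proof.
move=> u_lt.
have levL y : lev (u y) <= L by rewrite lev_le (leq_trans (u_lt y)) ?up_logP.
have gt_trans : transitive gt by move=> y z w yz yw; apply: lt_trans yw yz.
have gt_total y z : y != z -> lt z y || lt y z by rewrite eq_sym; apply: lt_total.
have H1 := records_ge u L (pairwise_beyond lt_trans lt_total x).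
have H2 := records_ge u L (pairwise_beyond gt_trans gt_total x).
apply: leq_trans (leq_add H1 H2); apply: leq_trans (leq_card_setU _ _).
apply/subset_leq_card/fintype.subsetP => w; rewrite !inE !mem_beyond !levL /=.
case/and3P=> w0 wx /forallP Hz; rewrite w0 /=.
have xw : x != w by rewrite eq_sym.
apply/orP; case/orP: (lt_total xw) => h; [left|right]; rewrite h; apply/allP => z.
  rewrite mem_beyond => /andP[z0 xz]; apply/implyP => zw.
  by apply: (implyP (Hz z)); rewrite z0 /between xz zw.
rewrite mem_beyond => /andP[z0 xz]; apply/implyP => zw.
by apply: (implyP (Hz z)); rewrite z0 /between xz zw orbT.
Qed.

(** One half for each side. As [(3 / 2) ^ 2 >= 2], the power [(3 / 2) ^ (6 * L + 8)] is at least
    [2 ^ (3 * L + 4)], hence at least [16 * n ^ 3]. *)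
Definition slow_bound : nat := 2 * (6 * L + 8).

(** Union bound over [n] processors and two sides: by [records_tail] each of these events has at
    most a fraction [4 * n / (16 * n ^ 3)] of all draws. *)
Lemma few_slow :
  #|[set f : F | slow_bound < slowest lt (fun x => f x)]| * (2 * n) <= #|{: F}|.
Proof.
pose t := (6 * L + 8)%N.
pose bad1 x := [set f : F | t <= records L [seq nat_of_ord (f y) | y <- beyond lt x]].
pose bad2 x := [set f : F | t <= records L [seq nat_of_ord (f y) | y <- beyond gt x]].
have sub : #|[set f : F | slow_bound < slowest lt (fun x => f x)]| <=
    \sum_x (#|bad1 x| + #|bad2 x|).
  apply: (@leq_trans #|\bigcup_x (bad1 x :|: bad2 x)|%SET); last first.
    elim/big_ind2: _ => [|A a B b HA HB|x _]; first by rewrite cards0.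
      exact: leq_trans (leq_card_setU _ _) (leq_add HA HB).
    exact: leq_card_setU.
  apply/subset_leq_card/fintype.subsetP => f; rewrite inE => h.
  have [x hx] : exists x, slow_bound < #|rivals lt (fun x => f x) x|.
    apply/existsP; apply: contraLR h; rewrite negb_exists -leqNgt => /forallP hx.
    by apply/bigmax_leqP => x _; rewrite leqNgt.
  apply/bigcupP; exists x => //; rewrite !inE.
  have := leq_trans hx (rivals_le x (fun y => ltn_ord (f y))).
  rewrite /slow_bound -/t; case: (leqP t) => //= h1; case: (leqP t) => // h2; lia.
have Ln : (2 ^ L.+1 <= 4 * n)%N.
  rewrite expnS; case: (n') => [|k]; first by rewrite up_log1.
  have := @up_log_gtn 2 k.+2 isT isT.
  have : 0 < up_log 2 k.+2 by rewrite up_log_gt0.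
  by case: (up_log 2 k.+2) => // j _ /= h; rewrite expnS; lia.
have nL : (n <= 2 ^ L)%N by apply: up_logP.
have gt_trans : transitive gt by move=> y z w yz yw; apply: lt_trans yw yz.
have gt_total y z : y != z -> lt z y || lt y z by rewrite eq_sym; apply: lt_total.
have B1 x := @records_tail rat _ n isT L t (beyond lt x) (uniq_beyond lt x) (size_beyond lt x).
have B2 x := @records_tail rat _ n isT L t (beyond gt x) (uniq_beyond gt x) (size_beyond gt x).
have big : ((16 * n ^ 3)%N%:R <= (3 / 2 : rat) ^+ t)%R.
  rewrite (_ : t = 2 * (3 * L + 4))%N; last by rewrite /t; lia.
  rewrite exprM; apply: le_trans (_ : ((2 ^ (3 * L + 4))%N%:R <= _)%R).
    by rewrite ler_nat expnD mulnC leq_mul2r /= mulnC expnM leq_exp2r.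
  have h : (2 <= (3 / 2) ^+ 2 :> rat)%R by lra.
  rewrite natrX; apply: lerXn2r h; rewrite nnegrE; first exact: ler0n.
  by apply: exprn_ge0; lra.
have small (c : nat) : (c%:R * (3 / 2 : rat) ^+ t <= #|{: F}|%:R * 2 ^+ L.+1)%R ->
    c * (4 * n * n) <= #|{: F}|.
  move=> /(le_trans (ler_wpM2l (ler0n _ c) big)).
  rewrite -natrX -!natrM ler_nat => h.
  have : c * (16 * n ^ 3) <= #|{: F}| * (4 * n).
    by apply: leq_trans h _; rewrite leq_mul2l Ln orbT.
  rewrite (_ : c * (16 * n ^ 3) = c * (4 * n * n) * (4 * n)); last by rewrite !expnS; lia.
  by rewrite leq_mul2r.
have total : (\sum_x (#|bad1 x| + #|bad2 x|)) * (4 * n * n) <= n * (2 * #|{: F}|).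
  rewrite big_distrl /= -[X in X * (2 * _)]card_ord -sum_nat_const.
  apply: leq_sum => x _; rewrite mulnDl mul2n -addnn.
  by apply: leq_add; apply: small; [exact: B1|exact: B2].
rewrite -(@leq_pmul2r (2 * n)) //; apply: leq_trans (_ : _ <= n * (2 * #|{: F}|)) _.
  apply: leq_trans total; rewrite -mulnA (_ : 2 * n * (2 * n) = 4 * n * n); last by lia.
  by rewrite leq_mul2r sub orbT.
lia.
Qed.

End Slow.

(** * Weakest-precondition rules *)

Section Rules.
Variables (disp : Order.disp_t) (T : orderType disp) (r bits n : nat).
Local Notation wrd := (word T).
Local Notation reg s k := (nth (Int 0) s (nat_of_ord k)).
Local Notation put s d v := (set_nth (Int 0) s (nat_of_ord d) v).
Variables (ss : seq (stmt r)) (Q : ('I_n -> seq wrd) -> ('I_n -> wrd) -> Prop).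
Variables (F : 'I_n -> seq wrd) (M : 'I_n -> wrd).

Lemma int_wordE k : k < 2 ^ bits -> int_word T bits k = Int k.
Proof. by move=> h; rewrite /int_word modn_small. Qed.

Lemma wp_ext F1 F2 : F1 =1 F2 -> wp bits ss Q F2 M -> wp bits ss Q F1 M.
Proof. by move=> /funext ->. Qed.

Lemma wp_nil : Q F M -> wp bits ([::] : seq (stmt r)) Q F M.
Proof. by []. Qed.

Lemma wp_const (d : 'I_r) k : k < 2 ^ bits ->
  wp bits ss Q (fun p => put (F p) d (Int k)) M -> wp bits (Ins (Const d k) :: ss) Q F M.
Proof. by move=> h; rewrite /wp /= int_wordE. Qed.

Lemma wp_size (d : 'I_r) : n < 2 ^ bits ->
  wp bits ss Q (fun p => put (F p) d (Int n)) M -> wp bits (Ins (Size d) :: ss) Q F M.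
Proof. by move=> h; rewrite /wp /= int_wordE. Qed.

Lemma wp_pid (d : 'I_r) : n < 2 ^ bits ->
  wp bits ss Q (fun p => put (F p) d (Int p)) M -> wp bits (Ins (Pid d) :: ss) Q F M.
Proof.
move=> h; apply: wp_ext => p.
by rewrite int_wordE // (ltn_trans (ltn_ord p)).
Qed.

Lemma wp_move (d a : 'I_r) (V : 'I_n -> wrd) : (forall p, reg (F p) a = V p) ->
  wp bits ss Q (fun p => put (F p) d (V p)) M -> wp bits (Ins (Move d a) :: ss) Q F M.
Proof.
by move=> h; apply: wp_ext => p; rewrite h.
Qed.

Lemma wp_arith o (d a b : 'I_r) (x y v : 'I_n -> nat) :
  (forall p, reg (F p) a = Int (x p)) -> (forall p, reg (F p) b = Int (y p)) ->
  (forall p, eval_arith o (x p) (y p) %% 2 ^ bits = v p) ->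
  wp bits ss Q (fun p => put (F p) d (Int (v p))) M ->
  wp bits (Ins (Arith o d a b) :: ss) Q F M.
Proof.
move=> hx hy hv W; exists x, y; split=> //.
by apply: wp_ext W => p; rewrite /int_word hv.
Qed.

Lemma wp_read (d a : 'I_r) (x : 'I_n -> 'I_n) (V : 'I_n -> wrd) :
  (forall p, reg (F p) a = Int (x p)) -> (forall p, M (x p) = V p) ->
  wp bits ss Q (fun p => put (F p) d (V p)) M -> wp bits (Ins (Read d a) :: ss) Q F M.
Proof.
move=> hx hv W; exists x; split=> //.
by apply: wp_ext W => p; rewrite hv.
Qed.

Lemma wp_sel (d x y a b : 'I_r) (c : 'I_n -> bool) (V : 'I_n -> wrd) :
  (forall p, word_le (reg (F p) x) (reg (F p) y) = Some (c p)) ->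
  (forall p, (if c p then reg (F p) a else reg (F p) b) = V p) ->
  wp bits ss Q (fun p => put (F p) d (V p)) M -> wp bits (Sel d x y a b :: ss) Q F M.
Proof.
move=> hx hv W; exists c; split=> //.
by apply: wp_ext W => p; rewrite hv.
Qed.

Lemma wp_wr (x y a b : 'I_r) (c : 'I_n -> bool) (adr : 'I_n -> 'I_n) (V : 'I_n -> wrd) :
  (forall p, word_le (reg (F p) x) (reg (F p) y) = Some (c p)) ->
  (forall p, c p -> reg (F p) a = Int (adr p)) -> (forall p, reg (F p) b = V p) ->
  (forall M' : 'I_n -> wrd,
    (forall i, (exists p, [/\ c p, adr p = i & M' i = V p]) \/
               (forall p, c p -> adr p <> i) /\ M' i = M i) -> wp bits ss Q F M') ->
  wp bits (Wr x y a b :: ss) Q F M.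
Proof.
move=> hx ha hv W; exists c, adr; split=> // M' H; apply: W => i.
by case: (H i) => [[p []]|]; [left; exists p; rewrite -hv|right].
Qed.

Lemma wp_own (x y a b : 'I_r) (V : 'I_n -> wrd) :
  (forall p, word_le (reg (F p) x) (reg (F p) y) = Some true) ->
  (forall p, reg (F p) a = Int p) -> (forall p, reg (F p) b = V p) ->
  wp bits ss Q F V -> wp bits (Wr x y a b :: ss) Q F M.
Proof.
move=> hx ha hv W.
apply: (wp_wr (c := fun=> true) (adr := id) hx _ hv) => [p _|M' H]; first exact: ha.
rewrite (_ : M' = V) //; apply: funext => i.
by case: (H i) => [[p [_ -> ->]]|[/(_ i isT)]].
Qed.

End Rules.
Arguments wp_own {disp T r bits n ss Q F M x y a b V}.

(** * The program *)

Local Notation register k := (@Ordinal 18 k isT).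
Local Notation rzero := (register 0).
Local Notation rone := (register 1).
Local Notation rsize := (register 2).
Local Notation rme := (register 3).
Local Notation relem := (register 4).
Local Notation rdraw := (register 5).
Local Notation runpl := (register 6).
Local Notation rgap := (register 7).
Local Notation rthr := (register 8).
Local Notation rnext := (register 9).
Local Notation rwin := (register 10).
Local Notation rnew := (register 11).
Local Notation rpivot := (register 12).
Local Notation rnextgap := (register 13).
Local Notation rtmp := (register 14).
Local Notation rflag := (register 15).
Local Notation rdist := (register 16).
Local Notation rhops := (register 17).

(** Registers start with 0, so [rgap] and [rnext] already refer to processor 0. *)
Definition setup : seq (stmt 18) :=
  [:: Ins (Const rone 1); Ins (Size rsize); Ins (Pid rme); Ins (Read relem rme);
      Sel runpl rme rzero rzero rone; Ins (Move rthr rone)].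

(* The cell of a placed processor collects the claims of the unplaced processors
   in its gap; [rsize] marks a cell without claims, and [rwin], [rnew] are the
   contents of the cells of [rgap] and of the processor itself.  An unplaced
   processor finds its own cell unclaimed. *)
Definition insertion : seq (stmt 18) :=
  [:: Wr rzero rzero rme rsize;
      Sel rtmp rthr rdraw rzero runpl;
      Wr rone rtmp rgap rme;
      Ins (Read rwin rgap);
      Ins (Read rnew rme);
      Wr rzero rzero rme rnext;
      Ins (Read rnextgap rgap);
      Wr rzero rzero rme relem;
      Sel rtmp rsize rwin rme rwin;
      Ins (Read rpivot rtmp);
      Sel rnext rsize rnew rnext rnew;
      Ins (Arith OpAdd rtmp rthr rthr);
      Sel rthr rsize rwin rtmp rthr;
      Sel rtmp rme rwin rzero rone;
      Sel rtmp rpivot relem rtmp rzero;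
      Sel rtmp relem rpivot rtmp rone;
      Sel rgap rone rtmp rwin rgap;
      Sel rtmp rme rwin rone rzero;
      Sel rtmp rwin rme rtmp rzero;
      Sel rnext rone rtmp rnextgap rnext;
      Sel runpl rone rtmp rzero runpl;
      Wr rzero rzero rzero rzero;
      Wr rone runpl rzero rone;
      Ins (Read rflag rzero)].

(** Processor 0 is made to point to itself at distance 0, which opens the circular list. *)
Definition ranking_init : seq (stmt 18) :=
  [:: Sel rnext rme rzero rzero rnext; Sel rdist rme rzero rzero rone;
      Ins (Const rhops 1)].

(** One pointer-jumping step: the cells publish the pointers first, then the distances; [rhops] is
    the jump length. *)
Definition doubling : seq (stmt 18) :=
  [:: Wr rzero rzero rme rnext;
      Ins (Read rwin rnext);
      Wr rzero rzero rme rdist;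
      Ins (Read rnew rnext);
      Ins (Arith OpAdd rdist rdist rnew);
      Ins (Move rnext rwin);
      Ins (Arith OpAdd rhops rhops rhops)].

(* Ranks among the list nodes differ from the ranks in the input by one for the
   elements below that of the head [0].  The only cell that no list node claims
   is the one of the head. *)
Definition output_phase : seq (stmt 18) :=
  [:: Wr rzero rzero rme relem;
      Ins (Read rpivot rzero);
      Sel rtmp rpivot relem rzero rone;
      Ins (Arith OpSub rgap rsize rdist);
      Ins (Arith OpSub rgap rgap rtmp);
      Wr rzero rzero rme rzero;
      Sel rtmp rme rzero rzero rone;
      Wr rone rtmp rgap rone;
      Ins (Read rflag rme);
      Wr rflag rzero rzero rme;
      Ins (Read rtmp rzero);
      Sel rgap rme rzero rtmp rgap;
      Wr rzero rzero rgap relem].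

(** * Correctness of the program blocks *)

Section Semantics.
Variables (disp : Order.disp_t) (T : orderType disp) (bits n' : nat).
Local Notation n := n'.+1.
Hypothesis bits_large : 8 * n < 2 ^ bits.
Variables (elt : 'I_n -> T) (u : 'I_n -> 'I_n).
Local Notation wrd := (word T).
Local Notation wp := (@wp _ T 18 bits n).

(** Ties are broken by processor number to obtain a strict total order. *)
Definition before (x y : 'I_n) : bool :=
  (elt x < elt y)%O || (elt x == elt y) && (x < y).

Lemma before_irr : irreflexive before.
Proof. by move=> x; rewrite /before ltxx ltnn andbF. Qed.

Lemma before_trans : transitive before.
Proof.
move=> y x z /orP[xy|/andP[/eqP xy lxy]] /orP[yz|/andP[/eqP yz lyz]]; rewrite /before.
- by rewrite (lt_trans xy yz).
- by rewrite -yz xy.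
- by rewrite xy yz.
- by rewrite xy yz eqxx (ltn_trans lxy lyz) orbT.
Qed.

Lemma before_total x y : x != y -> before x y || before y x.
Proof.
rewrite /before => xy; case: (ltgtP (elt x) (elt y)) => //= _.
by rewrite -neq_ltn.
Qed.

Record frame : Type := Frame {
  fwin : 'I_n -> wrd; fnew : 'I_n -> wrd; fpivot : 'I_n -> wrd;
  fnextgap : 'I_n -> wrd; ftmp : 'I_n -> wrd; fflag : 'I_n -> wrd;
  fdist : 'I_n -> wrd; fhops : 'I_n -> wrd
}.

Definition represents (S : state n') (X : frame) (p : 'I_n) : seq wrd :=
  [:: Int 0; Int 1; Int n; Int p; Elem (elt p); Int (u p); Int (unplaced S p);
      Int (gap S p); Int (thr S p); Int (nxt S p);
      fwin X p; fnew X p; fpivot X p; fnextgap X p; ftmp X p; fflag X p;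
      fdist X p; fhops X p].

Lemma wp_setup (Q : ('I_n -> seq wrd) -> ('I_n -> wrd) -> Prop) :
  (forall X M, Q (represents (start_state n') X) M) ->
  wp setup Q (fun p => set_nth (Int 0) (nseq 18 (Int 0)) rdraw (int_word T bits (u p)))
    (fun p => Elem (elt p)).
Proof.
move=> HQ; have B0 : 0 < 2 ^ bits by rewrite expn_gt0.
apply: wp_const => //=; first by lia.
apply: wp_size => /=; first by lia.
apply: wp_pid => /=; first by lia.
apply: (wp_read (x := id) (V := fun p => Elem (elt p))) => //=.
apply: (wp_sel (c := fun p => p == ord0) (V := fun p => Int (p != ord0))) => //=.
- by move=> p; rewrite leqn0.
- by move=> p; case: eqP.
apply: (wp_move (V := fun=> Int 1)) => //=.
apply: wp_nil.
have := HQ (Frame (fun=> Int 0) (fun=> Int 0) (fun=> Int 0) (fun=> Int 0) (fun=> Int 0)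
  (fun=> Int 0) (fun=> Int 0) (fun=> Int 0)) (fun p => Elem (elt p)).
congr Q; apply: funext => p; rewrite /represents /= int_wordE //.
by have := ltn_ord (u p); lia.
Qed.

Lemma wp_insertion k S X M (Q : ('I_n -> seq wrd) -> ('I_n -> wrd) -> Prop) :
  list_inv before (fun x => u x) k S ->
  (forall S' X' M', list_inv before (fun x => u x) k.+1 S' ->
     (forall p, fflag X' p = Int [exists x, unplaced S' x]) -> Q (represents S' X') M') ->
  wp insertion Q (represents S X) M.
Proof.
move=> I HQ; have B0 : 0 < 2 ^ bits by rewrite expn_gt0.
rewrite /represents.
apply: (wp_own (V := fun=> Int n)) => //=.
apply: (wp_sel (c := fun p => thr S p <= u p)
  (V := fun p => Int (unplaced S p && (u p < thr S p)))) => //=.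
  by move=> p; rewrite ltnNge; case: leqP; rewrite ?andbF ?andbT.
apply: (wp_wr (c := fun p => unplaced S p && (u p < thr S p)) (adr := gap S)
  (V := fun p => Int p)) => //=.
  by move=> p; rewrite lt0b.
move=> M1 H1.
(* The concurrent write leaves one claimant in each claimed cell; here the choice of the arbiter
   becomes [win]. *)
have [win Hwin] : {win : 'I_n -> option 'I_n & forall i,
    if win i is Some w then cand u S i w /\ M1 i = Int w
    else (forall x, ~~ cand u S i x) /\ M1 i = Int n}.
  apply: (@choice _ _ (fun i o => if o is Some w then cand u S i w /\ M1 i = Int w
    else (forall x, ~~ cand u S i x) /\ M1 i = Int n)) => i.
  case: (H1 i) => [[p [cp gp Mi]]|[no Mi]].
    by exists (Some p); split=> //; rewrite /cand gp eqxx andbC; move: cp => /andP[-> ->].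
  exists None; split=> // x; apply/negP => /and3P[ux /eqP gx tx].
  by apply: (no x) => //; rewrite ux.
pose wv i : nat := if win i is Some w then w else n.
have EM : M1 = fun i => Int (wv i).
  by apply: funext => i; rewrite /wv; have := Hwin i; case: (win i) => [w|] [].
(* Without a winner a processor is its own pivot, which keeps the next read valid and makes
   [before (tgt p) p] false. *)
pose tgt p := odflt p (win (gap S p)).
have wvP p : wv (gap S p) = if win (gap S p) is Some w then w : nat else n by [].
rewrite {H1}EM.
apply: (wp_read (x := gap S) (V := fun p => Int (wv (gap S p)))) => //=.
apply: (wp_read (x := id) (V := fun p => Int (wv p))) => //=.
apply: (wp_own (V := fun p => Int (nxt S p))) => //=.
apply: (wp_read (x := gap S) (V := fun p => Int (nxt S (gap S p)))) => //=.
apply: (wp_own (V := fun p => Elem (elt p))) => //=.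
apply: (wp_sel (c := fun p => n <= wv (gap S p)) (V := fun p => Int (tgt p))) => //=.
  by move=> p; rewrite wvP /tgt; case: (win _) => [w|]; rewrite ?leqnn // leqNgt ltn_ord.
apply: (wp_read (x := tgt) (V := fun p => Elem (elt (tgt p)))) => //=.
apply: (wp_sel (c := fun p => n <= wv p) (V := fun p => Int (odflt (nxt S p) (win p)))) => //=.
  by move=> p; rewrite /wv; case: (win _) => [w|]; rewrite ?leqnn // leqNgt ltn_ord.
(* The sum may wrap around for placed processors, whose thresholds are meaningless; thresholds of
   unplaced ones are below [2 * n]. *)
apply: (wp_arith (x := thr S) (y := thr S)
  (v := fun p => (thr S p + thr S p) %% 2 ^ bits)) => //=.
pose thr' p := if win (gap S p) is Some _ then thr S p else (thr S p + thr S p) %% 2 ^ bits.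
apply: (wp_sel (c := fun p => n <= wv (gap S p)) (V := fun p => Int (thr' p))) => //=.
  by move=> p; rewrite wvP /thr'; case: (win _) => [w|]; rewrite ?leqnn // leqNgt ltn_ord.
apply: (wp_sel (c := fun p => p <= wv (gap S p))
  (V := fun p => Int (wv (gap S p) < p))) => //=.
  by move=> p; case: (leqP p (wv (gap S p))).
apply: (wp_sel (c := fun p => (elt (tgt p) <= elt p)%O)
  (V := fun p => Int ((elt (tgt p) <= elt p)%O && (wv (gap S p) < p)))) => //=.
  by move=> p; case: ifP.
apply: (wp_sel (c := fun p => (elt p <= elt (tgt p))%O)
  (V := fun p => Int (before (tgt p) p))) => //=.
  move=> p; rewrite /before wvP /tgt; case: (win _) => [w|] /=; first by case: ltgtP.
  by rewrite ltxx lexx eqxx ltnn ltnNge (ltnW (ltn_ord p)).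
pose gap' p := if before (tgt p) p then tgt p else gap S p.
apply: (wp_sel (c := fun p => before (tgt p) p) (V := fun p => Int (gap' p))) => //=.
- by move=> p; rewrite lt0b.
- move=> p; rewrite /gap'; case: ifP => //; rewrite wvP /tgt.
  by case: (win _) => [w|] //=; rewrite before_irr.
apply: (wp_sel (c := fun p => p <= wv (gap S p))
  (V := fun p => Int (p <= wv (gap S p)))) => //=.
  by move=> p; case: ifP.
apply: (wp_sel (c := fun p => wv (gap S p) <= p)
  (V := fun p => Int (wv (gap S p) == p))) => //=.
  by move=> p; case: (ltngtP (wv (gap S p)) p).
pose nxt' p := if wv (gap S p) == p then nxt S (gap S p) else odflt (nxt S p) (win p).
apply: (wp_sel (c := fun p => wv (gap S p) == p) (V := fun p => Int (nxt' p))) => //=.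
- by move=> p; rewrite lt0b.
- by move=> p; rewrite /nxt'; case: ifP.
pose unplaced' p := unplaced S p && (wv (gap S p) != p).
apply: (wp_sel (c := fun p => wv (gap S p) == p) (V := fun p => Int (unplaced' p))) => //=.
- by move=> p; rewrite lt0b.
- by move=> p; rewrite /unplaced'; case: ifP; rewrite ?andbF ?andbT.
(* A disjunction in constant time: cell 0 is cleared, then all unplaced processors write 1 to it;
   conflicting writes agree. *)
apply: (wp_wr (c := fun=> true) (adr := fun=> ord0) (V := fun=> Int 0)) => //= M2 H2.
apply: (wp_wr (c := unplaced') (adr := fun=> ord0) (V := fun=> Int 1)) => //=.
  by move=> p; rewrite lt0b.
move=> M3 H3.
apply: (wp_read (x := fun=> ord0) (V := fun=> Int [exists x, unplaced' x])) => //=.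
  move=> _; have [[p [up _ ->]]|[no ->]] := H3 ord0.
    by rewrite (_ : [exists x, unplaced' x]); last by apply/existsP; exists p.
  have [[p [_ _ ->]]|[/(_ ord0 isT)//]] := H2 ord0.
  by rewrite (_ : [exists x, unplaced' x] = false) //; apply/negbTE/existsP => -[q /no].
apply: wp_nil.
have R : ins_round before (fun x => u x) win S (State unplaced' gap' thr' nxt').
  split=> [v w E|v x E|x /=].
  - by have := Hwin v; rewrite E => -[].
  - by have := Hwin v; rewrite E => -[].
  rewrite /unplaced' /nxt' /thr' /gap' /tgt wvP; case ux : (unplaced S x); last first.
    split=> //; case E: (win (gap S x)) => [w|]; last by rewrite gtn_eqF.
    have := Hwin (gap S x); rewrite E => -[/and3P[uw _ _] _].
    by case: eqP => // /val_inj wx; rewrite wx ux in uw.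
  case E: (win (gap S x)) => [w|] /=.
    rewrite -[w == x]val_eqE /=; case: eqP => //= _; by split.
  rewrite gtn_eqF // before_irr; split=> //; rewrite modn_small //.
  have [j [-> [->|h] _]] := inv_time I ux; first by rewrite expn0; lia.
  by have := ltn_ord (u x); lia.
have I' := round_inv before_irr before_trans before_total I R.
apply: (HQ _ (Frame (fun p => Int (wv (gap S p))) (fun p => Int (wv p))
  (fun p => Elem (elt (tgt p))) (fun p => Int (nxt S (gap S p)))
  (fun p => Int (wv (gap S p) == p)) (fun=> Int [exists x, unplaced' x])
  (fdist X) (fhops X)) M3 I').
by [].
Qed.

(** Pointers lead [2 ^ i] nodes ahead; truncated subtraction accounts for those that have reached
    [ord0], whose tail is 0. *)
Definition linked (i : nat) (S : state n') (X : frame) : Prop :=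
  forall p, [/\ fdist X p = Int (tail before p - tail before (nxt S p)),
    tail before (nxt S p) = tail before p - 2 ^ i & fhops X p = Int (2 ^ i)].

Lemma tail_ltn p : tail before p < n.
Proof.
rewrite /tail; case: eqP => // _; rewrite -[X in _ < X]card_ord -cardsT.
apply: proper_card; rewrite properE finset.subsetT; apply/fintype.subsetPn.
by exists ord0; rewrite ?inE ?eqxx.
Qed.

Lemma wp_ranking_init k S X M (Q : ('I_n -> seq wrd) -> ('I_n -> wrd) -> Prop) :
  list_inv before (fun x => u x) k S -> (forall x, unplaced S x = false) ->
  (forall S' X' M', linked 0 S' X' -> Q (represents S' X') M') ->
  wp ranking_init Q (represents S X) M.
Proof.
move=> I pl HQ; rewrite /represents.
pose nxt' p := if p == ord0 then ord0 else nxt S p.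
apply: (wp_sel (c := fun p => p == ord0) (V := fun p => Int (nxt' p))) => //=.
- by move=> p; rewrite leqn0.
- by move=> p; rewrite /nxt'; case: eqP.
apply: (wp_sel (c := fun p => p == ord0) (V := fun p => Int (p != ord0))) => //=.
- by move=> p; rewrite leqn0.
- by move=> p; case: eqP.
apply: wp_const => /=; first by lia.
apply: (HQ (State (unplaced S) (gap S) (thr S) nxt') (Frame (fwin X) (fnew X) (fpivot X)
  (fnextgap X) (ftmp X) (fflag X) (fun p => Int (p != ord0)) (fun=> Int 1)) M) => p /=.
rewrite /nxt' expn0; case: eqVneq => [->|p0]; first by rewrite /tail eqxx.
rewrite (tail_nxt before_irr before_trans before_total I pl p0) subn1; split=> //.
have : 0 < tail before p; last by case: (tail _ _) => // m _; rewrite subSnn.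
by rewrite /tail (negbTE p0) card_gt0; apply/set0Pn; exists p; rewrite inE p0 before_irr.
Qed.

Lemma wp_doubling i S X M (Q : ('I_n -> seq wrd) -> ('I_n -> wrd) -> Prop) :
  linked i S X -> 2 ^ i <= n ->
  (forall S' X' M', linked i.+1 S' X' -> Q (represents S' X') M') ->
  wp doubling Q (represents S X) M.
Proof.
move=> Lk i_n HQ; rewrite /represents.
apply: (wp_own (V := fun p => Int (nxt S p))) => //=.
apply: (wp_read (x := nxt S) (V := fun p => Int (nxt S (nxt S p)))) => //=.
pose dist p := tail before p - tail before (nxt S p).
apply: (wp_own (V := fun p => Int (dist p))) => //=; first by move=> p; have [] := Lk p.
apply: (wp_read (x := nxt S) (V := fun p => Int (dist (nxt S p)))) => //=.
apply: (wp_arith (x := dist) (y := fun p => dist (nxt S p))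
  (v := fun p => tail before p - tail before (nxt S (nxt S p)))) => //=.
- by move=> p; have [] := Lk p.
- move=> p; rewrite /dist; have [_ e1 _] := Lk p; have [_ e2 _] := Lk (nxt S p).
  have := tail_ltn p; rewrite modn_small; lia.
apply: (wp_move (V := fun p => Int (nxt S (nxt S p)))) => //=.
apply: (wp_arith (x := fun=> 2 ^ i) (y := fun=> 2 ^ i) (v := fun=> 2 ^ i.+1)) => //=.
- by move=> p; have [] := Lk p.
- by move=> p; have [] := Lk p.
- by move=> _; rewrite addnn -mul2n expnS modn_small //; lia.
apply: (HQ (State (unplaced S) (gap S) (thr S) (fun p => nxt S (nxt S p)))
  (Frame (fun p => Int (nxt S (nxt S p))) (fun p => Int (dist (nxt S p))) (fpivot X)
  (fnextgap X) (ftmp X) (fflag X)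
  (fun p => Int (tail before p - tail before (nxt S (nxt S p)))) (fun=> Int (2 ^ i.+1))) 
  (fun p => Int (dist p))) => p /=.
split=> //; have [_ e1 _] := Lk p; have [_ -> _] := Lk (nxt S p).
by rewrite e1 expnS; lia.
Qed.

Definition rank_ord (p : 'I_n) : 'I_n := Ordinal (rank_of_ltn before_irr p).

Lemma rank_ord_inj : injective rank_ord.
Proof. by move=> x y [] /(rank_of_inj before_irr before_trans before_total). Qed.

Lemma wp_output i S X M (Q : ('I_n -> seq wrd) -> ('I_n -> wrd) -> Prop) :
  linked i S X -> n < 2 ^ i ->
  (forall F M', (forall p, M' (rank_ord p) = Elem (elt p)) -> Q F M') ->
  wp output_phase Q (represents S X) M.
Proof.
move=> Lk i_n HQ; have B0 : 0 < 2 ^ bits by rewrite expn_gt0.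
(* Jumps of more than [n] nodes end at [ord0], so the distance is the whole tail. *)
have ED p : fdist X p = Int (tail before p).
  have [-> -> _] := Lk p; congr Int; have := tail_ltn p; lia.
have rkE p : p != ord0 -> (n - tail before p) - before p ord0 = rank_ord p.
  move=> /(rank_of_tail before_irr before_trans before_total) /=.
  set a := rank_of _ _; set b := tail _ _; move: (nat_of_bool _) => c; lia.
rewrite /represents.
apply: (wp_own (V := fun p => Elem (elt p))) => //=.
apply: (wp_read (x := fun=> ord0) (V := fun=> Elem (elt ord0))) => //=.
apply: (wp_sel (c := fun p => (elt ord0 <= elt p)%O) (V := fun p => Int (before p ord0))) => //=.
  by move=> p; rewrite /before ltn0 andbF orbF ltNge; case: ifP.
apply: (wp_arith (x := fun=> n) (y := fun p => tail before p)
  (v := fun p => n - tail before p)) => //=.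
  by move=> p; rewrite modn_small //; lia.
apply: (wp_arith (x := fun p => n - tail before p) (y := fun p => before p ord0)
  (v := fun p => n - tail before p - before p ord0)) => //=.
  by move=> p; rewrite modn_small //; lia.
apply: (wp_own (V := fun=> Int 0)) => //=.
apply: (wp_sel (c := fun p => p == ord0) (V := fun p => Int (p != ord0))) => //=.
- by move=> p; rewrite leqn0.
- by move=> p; case: eqP.
apply: (wp_wr (c := fun p => p != ord0) (adr := rank_ord) (V := fun=> Int 1)) => //=.
- by move=> p; rewrite lt0b.
- by move=> p p0; rewrite rkE.
move=> M1 H1.
have EM1 q : M1 q = Int (q != rank_ord ord0).
  have [[p [p0 <- ->]]|[no ->]] := H1 q; first by rewrite (inj_eq rank_ord_inj) p0.
  have [g _ gK] := injF_bij rank_ord_inj; rewrite -(gK q) (inj_eq rank_ord_inj).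
  by case: eqP => // /eqP /no; rewrite gK.
apply: (wp_read (x := id) (V := fun p => Int (p != rank_ord ord0))) => //=.
(* Only the processor whose own cell is unclaimed writes, so processor 0 learns its rank from cell
   0. *)
apply: (wp_wr (c := fun p => p == rank_ord ord0) (adr := fun=> ord0) (V := fun p => Int p)) => //=.
  by move=> p; rewrite leqn0 eqb0 negbK.
move=> M2 H2.
apply: (wp_read (x := fun=> ord0) (V := fun=> Int (rank_ord ord0))) => //=.
  move=> _; have [[p [/eqP -> _ ->//]]|[/(_ (rank_ord ord0))]] := H2 ord0.
  by rewrite eqxx => /(_ isT).
apply: (wp_sel (c := fun p => p == ord0) (V := fun p => Int (rank_ord p))) => //=.
- by move=> p; rewrite leqn0.
- by move=> p; case: eqVneq => [->|/rkE ->].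
apply: (wp_wr (c := fun=> true) (adr := rank_ord) (V := fun p => Elem (elt p))) => //= M3 H3.
apply: wp_nil; apply: HQ => p.
have [[q [_ /rank_ord_inj -> ->//]]|[/(_ p isT)//]] := H3 (rank_ord p).
Qed.

End Semantics.

(* Block sizes do not depend on the address, so 0 serves as a dummy. *)
Definition insertion_start := 1 + size (asms 1 setup).
Definition ranking_start := insertion_start + size (asms 0 insertion) + 1.
Definition doubling_start := ranking_start + size (asms 0 ranking_init).
Definition output_start := doubling_start + size (asms 0 doubling) + 1.

Definition sort_code : program 18 :=
  Rand rdraw :: asms 1 setup ++
  asms insertion_start insertion ++
  JumpLe rone rflag insertion_start ::
  asms ranking_start ranking_init ++
  asms doubling_start doubling ++
  JumpLe rhops rsize doubling_start ::
  asms output_start output_phase ++ [:: Halt].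

(** The duration of one pass through all blocks, with 1 for the draw and [.+1] for each loop test;
    no block is executed more than [(L + slow).+1] times. *)
Definition time_factor : nat :=
  1 + durations setup + (durations insertion).+1 + durations ranking_init +
  (durations doubling).+1 + durations output_phase.

Lemma code_setup : code_at sort_code 1 (asms 1 setup).
Proof. by apply: code_at_drop; vm_compute. Qed.

Lemma code_insertion : code_at sort_code insertion_start (asms insertion_start insertion).
Proof. by apply: code_at_drop; vm_compute. Qed.

Lemma code_ranking_init : code_at sort_code ranking_start (asms ranking_start ranking_init).
Proof. by apply: code_at_drop; vm_compute. Qed.

Lemma code_doubling : code_at sort_code doubling_start (asms doubling_start doubling).
Proof. by apply: code_at_drop; vm_compute. Qed.

Lemma code_output_phase : code_at sort_code output_start (asms output_start output_phase).
Proof. by apply: code_at_drop; vm_compute. Qed.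

Lemma insertion_jump : nth Halt sort_code
  (insertion_start + size (asms insertion_start insertion)) =
  JumpLe rone rflag insertion_start.
Proof. by vm_compute. Qed.

Lemma doubling_jump : nth Halt sort_code
  (doubling_start + size (asms doubling_start doubling)) =
  JumpLe rhops rsize doubling_start.
Proof. by vm_compute. Qed.

(** * Running time of the whole program *)

Section Execution.
Variables (disp : Order.disp_t) (T : orderType disp) (bits n' : nat).
Local Notation n := n'.+1.
Hypothesis bits_large : 8 * n < 2 ^ bits.
Variables (adv : arbiter T 18 n) (input : n.-tuple T) (u : nat -> 'I_n -> 'I_n).
Hypothesis adv_ok : valid_arbiter sort_code adv.
Local Notation conf t := (run sort_code bits adv input u t).2.
Local Notation elt := (tnth input).
Local Notation lt := (before elt).
Local Notation draw := (fun x => nat_of_ord (u 0 x)).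
Local Notation slow := (slowest lt draw).
Local Notation L := (up_log 2 n).

Lemma conf1 : conf 1 = aligned 1
  (fun p => set_nth (Int 0) (nseq 18 (Int 0)) rdraw (int_word T bits (u 0 p)))
  (fun p => Elem (elt p)).
Proof.
have E0 : conf 0 = Config (fun=> Processor 0 (fun=> Int 0)) (fun p => Elem (elt p)) by [].
rewrite (conf_step E0) //; congr Config; apply: funext => p.
rewrite /proc_step /fetch [nth _ _ _]/=; congr Processor.
have regs0 : regs_of (nseq 18 (Int 0)) = (fun=> Int 0) :> ('I_18 -> word T).
  by apply: funext => k; rewrite /regs_of nth_nseq if_same.
by rewrite -regs_of_put regs0.
Qed.

Lemma run_insertion m k S X M t :
  conf t = aligned insertion_start (represents elt (u 0) S X) M ->
  list_inv lt draw k S -> L + slow <= k + m ->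
  exists t' k' S' X' M', [/\ conf t' = aligned ranking_start (represents elt (u 0) S' X') M',
    list_inv lt draw k' S', forall x, unplaced S' x = false &
    t' <= t + m.+1 * (durations insertion).+1].
Proof.
elim: m k S X M t => [|m IH] k S X M t Et I km.
all: have [F' [M1 [Et1 [S' [X' [F'E I' Hf]]]]]] := exec adv_ok Et
  code_insertion
  (wp_insertion bits_large X M (Q := fun F' _ => exists S' X', [/\ F' = represents elt (u 0) S' X',
     list_inv lt draw k.+1 S' & forall p, fflag X' p = Int [exists x, unplaced S' x]]) I
     (fun S' X' M' I' H => ex_intro _ S' (ex_intro _ X' (And3 erefl I' H)))).
all: subst F'; have He p : word_le (nth (Int 0) (represents elt (u 0) S' X' p) rone)
    (nth (Int 0) (represents elt (u 0) S' X' p) rflag) =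
    Some [exists x, unplaced S' x] by rewrite /= Hf; case: [exists _, _].
all: have := exec_jump Et1 insertion_jump He.
all: case: existsP => [[x ux]|nx] Et2.
(* The budget is exhausted, that is [L + slow <= k], so a processor still unplaced after round
   [k.+1] contradicts [inv_bound]. *)
- have := inv_bound (fun x => ltn_ord (u 0 x)) I' ux; lia.
- exists (t + durations insertion).+1, k.+1, S', X', M1; split=> //; last by lia.
  by move=> x; apply/negP => ux; apply: nx; exists x.
- have [|t' [k' [S2 [X2 [M2 [E2 I2 pl2 le2]]]]]] := IH k.+1 S' X' M1 _ Et2 I'; first by lia.
  exists t', k', S2, X2, M2; split=> //; apply: leq_trans le2 _.
  by rewrite [m.+2 * _]mulSn; lia.
- exists (t + durations insertion).+1, k.+1, S', X', M1; split=> //; last by nia.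
  by move=> x; apply/negP => ux; apply: nx; exists x.
Qed.

Lemma run_doubling m i S X M t :
  conf t = aligned doubling_start (represents elt (u 0) S X) M ->
  linked elt i S X -> 2 ^ i <= n -> L <= i + m ->
  exists t' i' S' X' M', [/\ conf t' = aligned output_start (represents elt (u 0) S' X') M',
    linked elt i' S' X', n < 2 ^ i' & t' <= t + m.+1 * (durations doubling).+1].
Proof.
elim: m i S X M t => [|m IH] i S X M t Et Lk i_n im.
all: have [F' [M1 [Et1 [S' [X' [F'E Lk']]]]]] := exec adv_ok Et
  code_doubling
  (wp_doubling bits_large M (Q := fun F' _ => exists S' X', F' = represents elt (u 0) S' X' /\
     linked elt i.+1 S' X') Lk i_n
     (fun S' X' M' H => ex_intro _ S' (ex_intro _ X' (conj erefl H)))).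
all: subst F'; have He p : word_le (nth (Int 0) (represents elt (u 0) S' X' p) rhops)
    (nth (Int 0) (represents elt (u 0) S' X' p) rsize) = Some (2 ^ i.+1 <= n)
  by have [_ _] := Lk' p; rewrite /= => ->.
all: have := exec_jump Et1 doubling_jump He.
all: case: leqP => in' Et2.
- have := leq_trans in' (up_logP n (isT : 1 < 2)); rewrite leq_exp2l //; lia.
- exists (t + durations doubling).+1, i.+1, S', X', M1; split=> //; lia.
- have [|t' [k' [S2 [X2 [M2 [E2 I2 pl2 le2]]]]]] := IH i.+1 S' X' M1 _ Et2 Lk' in'; first by lia.
  exists t', k', S2, X2, M2; split=> //; apply: leq_trans le2 _.
  by rewrite [m.+2 * _]mulSn; lia.
- exists (t + durations doubling).+1, i.+1, S', X', M1; split=> //; nia.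
Qed.

Lemma run_total : exists t F M, [/\ conf t = aligned (size sort_code).-1 F M,
  forall p, M (rank_ord elt p) = Elem (elt p) &
  t <= time_factor * (L + slow).+1].
Proof.
have [F1 [M1 [E1 [S1 [X1 [F1E I1]]]]]] := exec adv_ok conf1
  code_setup
  (wp_setup bits_large (Q := fun F' _ => exists S' X', F' = represents elt (u 0) S' X' /\
     list_inv lt draw 0 S') (elt := elt) (u := u 0)
     (fun X' M' => ex_intro _ (start_state n') (ex_intro _ X' (conj erefl (inv_init _ _))))).
rewrite {F1}F1E in E1.
have [t2 [k2 [S2 [X2 [M2 [E2 I2 pl2 le2]]]]]] := run_insertion (m := L + slow) E1 I1 (leqnn _).
have [F3 [M3 [E3 [S3 [X3 [F3E Lk3]]]]]] := exec adv_ok E2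
  code_ranking_init
  (wp_ranking_init bits_large X2 M2
     (Q := fun F' _ => exists S' X', F' = represents elt (u 0) S' X' /\
     linked elt 0 S' X') I2 pl2
     (fun S' X' M' H => ex_intro _ S' (ex_intro _ X' (conj erefl H)))).
rewrite {F3}F3E in E3.
have [t4 [i4 [S4 [X4 [M4 [E4 Lk4 n4 le4]]]]]] :=
  run_doubling (m := L) E3 Lk3 (isT : 2 ^ 0 <= n) (leqnn _).
have [F5 [M5 [E5 H5]]] := exec adv_ok E4
  code_output_phase
  (wp_output bits_large (u 0) M4
     (Q := fun _ M' => forall p, M' (rank_ord elt p) = Elem (elt p)) Lk4 n4
     (fun F' M' H => H)).
exists (t4 + durations output_phase), F5, M5; split=> //.
rewrite /time_factor; move: le2 le4.
move: (durations setup) (durations insertion) (durations ranking_init) (durations doubling)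
  (durations output_phase) => a b c d e; nia.
Qed.

End Execution.

(** * Sorted output, span and work of a single run *)

Section Outcome.
Variables (disp : Order.disp_t) (T : orderType disp) (bits n' : nat).
Local Notation n := n'.+1.
Hypothesis bits_large : 8 * n < 2 ^ bits.
Variables (adv : arbiter T 18 n) (input : n.-tuple T) (u : nat -> 'I_n -> 'I_n).
Hypothesis adv_ok : valid_arbiter sort_code adv.
Local Notation elt := (tnth input).
Local Notation slow := (slowest (before elt) (fun x => u 0 x)).
Local Notation L := (up_log 2 n).

Lemma run_stops t p : time_factor * (L + slow).+1 <= t ->
  running sort_code bits adv input u t p = false.
Proof.
move=> le_t; have [t0 [F [M [Et _ let0]]]] := run_total bits_large input u adv_ok.
have := conf_halted (t - t0) Et (erefl : nth Halt sort_code _ = _).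
rewrite subnKC; last exact: leq_trans let0 le_t.
by move=> E; rewrite /running E.
Qed.

Lemma run_sorts_input : run_sorts sort_code bits adv input u.
Proof.
have [t [F [M [Et HM _]]]] := run_total bits_large input u adv_ok.
exists t; split=> [p|]; first by rewrite /running Et.
have inj := @rank_ord_inj _ _ _ elt; have [g rK gK] := injF_bij inj.
have g_inj := can_inj gK.
(* As [g] inverts [rank_ord], cell [i] holds the element of the processor of rank [i]. *)
exists (mktuple (fun i => elt (g i))); split.
- apply/(sortedP (elt ord0)) => i; rewrite size_tuple => i1.
  have i0 := ltn_trans (ltnSn i) i1.
  have nthE j (jn : j < n) : nth (elt ord0) (mktuple (fun i => elt (g i))) j =
      elt (g (Ordinal jn)) by exact: nth_mktuple (Ordinal jn).
  rewrite (nthE _ i0) (nthE _ i1).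
  rewrite leNgt; apply/negP => lt_g.
  have := rank_of_lt (@before_irr _ _ _ elt) (@before_trans _ _ _ elt)
    (ltac:(by rewrite /before lt_g) : before elt (g (Ordinal i1)) (g (Ordinal i0))).
  have /(congr1 val)/= e0 := gK (Ordinal i0); have /(congr1 val)/= e1 := gK (Ordinal i1).
  by rewrite e0 e1 ltnNge leqnSn.
- apply/tuple_permP; exists (perm g_inj).
  by congr val; apply: eq_mktuple => i; rewrite permE.
- by move=> i; rewrite Et /= tnth_mktuple -{1}(gK i) HM.
Qed.

Local Open Scope ereal_scope.

Lemma ops_le (R : realType) p :
  ops sort_code bits adv input u R p <= (time_factor * (L + slow).+1)%N%:R%:E.
Proof.
set N := (time_factor * _)%N; rewrite /ops.
rewrite (nneseries_split 0 N); last by move=> k _; rewrite lee_fin.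
rewrite add0n eseries0; last by move=> k Nk _; rewrite run_stops.
rewrite adde0 sumEFin lee_fin -[leRHS](_ : \sum_(0 <= t < N) 1 = _)%R.
  by apply: ler_sum => k _; rewrite lern1 leq_b1.
by rewrite big_const_nat subn0 iter_addr_0.
Qed.

Lemma span_le (R : realType) :
  pram_span sort_code bits adv input u R <= (time_factor * (L + slow).+1)%N%:R%:E.
Proof.
rewrite /pram_span; elim/big_ind: _ => [|x y hx hy|p _]; first by rewrite lee_fin.
  by rewrite ge_max hx.
exact: ops_le.
Qed.

Lemma work_le (R : realType) :
  pram_work sort_code bits adv input u R <= (n * (time_factor * (L + slow).+1))%N%:R%:E.
Proof.
apply: le_trans (lee_sum _ (fun p _ => ops_le R p)) _.
by rewrite sumEFin sumr_const card_ord -mulrnA mulnC.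
Qed.

Lemma work_ge0 (R : realType) : 0 <= pram_work sort_code bits adv input u R.
Proof.
by apply: sume_ge0 => p _; apply: nneseries_ge0 => k _ _; rewrite lee_fin.
Qed.

End Outcome.

Definition draw_free (i : instr 18) : bool :=
  match i with
  | Rand _ => false
  | Jump l | JumpLe _ _ l => 0 < l
  | _ => true
  end.

(* [Rand] occurs only at address 0, which is never reached again. *)
Lemma run_first_draw (disp : Order.disp_t) (T : orderType disp) bits n
    (adv : arbiter T 18 n) (input : n.-tuple T) (u v : nat -> 'I_n -> 'I_n) :
  u 0 = v 0 -> run sort_code bits adv input u = run sort_code bits adv input v.
Proof.
move=> uv; apply: funext => t.
suff [] : run sort_code bits adv input u t = run sort_code bits adv input v t /\
  (0 < t -> forall p, 0 < pc (procs (run sort_code bits adv input u t).2 p)) by [].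
have free k : 0 < k -> draw_free (nth Halt sort_code k).
  case: k => // k _; rewrite -nth_behead.
  have /all_nthP H : all draw_free (behead sort_code) by vm_compute.
  have [ks|ks] := ltnP k (size (behead sort_code)); first exact: H.
  by rewrite nth_default.
elim: t => [|t [IH pos]]; first by [].
split.
- rewrite /= IH; case E: (run sort_code bits adv input v t) => [past c].
  congr pair; rewrite /pram_step; congr Config; apply: funext => p.
  case: t E IH pos => [_ _ _|t E IH pos]; first by rewrite uv.
  have := free _ (pos isT p); rewrite IH E /proc_step /fetch /=.
  by case: nth.
- move=> _ p; rewrite /=; case E: (run _ _ _ _ _ _) => [past c] /=.
  rewrite /proc_step /fetch.
  have [p0|p0] := posnP (pc (procs c p)).
    by rewrite p0.
  have := free _ p0; case: nth => //= [op d a b|a b l|d a|a b].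
  + by case: (regs _ _) => // x; case: (regs _ _).
  + by case: word_le => // -[].
  + by case: address.
  + by case: address.
Qed.

Local Open Scope classical_set_scope.
Local Open Scope ring_scope.

(** * Probability *)

Section FirstDraw.
Variables (R : realType) (d : measure_display) (Omega : measurableType d).
Variables (P : probability Omega R) (n' : nat).
Local Notation n := n'.+1.
Variable U : nat -> 'I_n -> Omega -> 'I_n.
Hypothesis iid : iid_uniform P U.
Local Notation F := {ffun 'I_n -> 'I_n}.

(** The only randomness a run depends on. It is uniform on a finite set, so probabilities become
    ratios of cardinalities. *)
Definition first_draw (w : Omega) : F := [ffun p => U 0 p w].

Lemma measurable_draw f : measurable [set w | first_draw w = f].
Proof.
have [mU _ _] := iid.
rewrite (_ : [set w | _] = \bigcap_(p in [set: 'I_n]) [set w | U 0 p w = f p]).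
  by apply: fin_bigcap_measurable => // p _; apply: mU.
apply/seteqP; split=> [w /= <- p _|w /= H]; first by rewrite /= ffunE.
by apply/ffunP => p; rewrite ffunE; apply: H.
Qed.

Lemma prob_draw f : P [set w | first_draw w = f] = (#|{: F}|%:R^-1)%:E.
Proof.
have [_ pU iU] := iid.
have uJ : uniq [seq (0%N, p) | p <- enum 'I_n].
  by rewrite map_inj_uniq ?enum_uniq // => p q [].
have := iU _ (fun j => f j.2) uJ; rewrite big_map.
rewrite (_ : [set w | _] = [set w | first_draw w = f]).
  move=> ->; under eq_bigr do rewrite pU.
  rewrite prodEFin big_const_seq count_predT size_enum_ord iter_mulr_1.
  by rewrite card_ffun card_ord exprVn natrX.
apply/seteqP; split=> [w /= H|w /= <- [t p] /mapP[q _ [-> ->]]]; last by rewrite ffunE.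
apply/ffunP => p; rewrite ffunE; apply: (H (0%N, p)).
by apply: map_f; rewrite mem_enum.
Qed.

Lemma draws_in (s : seq F) : uniq s ->
  measurable [set w | first_draw w \in s] /\
  P [set w | first_draw w \in s] = ((size s)%:R / #|{: F}|%:R)%:E.
Proof.
elim: s => [_|f s IH /andP[fs us]].
  rewrite (_ : [set w | _] = set0); last by apply/seteqP; split=> w.
  by split; rewrite ?measure0 ?mul0r.
have [ms Ps] := IH us.
rewrite (_ : [set w | _] = [set w | first_draw w = f] `|` [set w | first_draw w \in s]).
  have mf := measurable_draw f; split; first exact: measurableU.
  have -> : P ([set w | first_draw w = f] `|` [set w | first_draw w \in s]) =
      (P [set w | first_draw w = f] + P [set w | first_draw w \in s])%E.
    apply: measureU => //; apply/seteqP; split=> w //= [-> fs'].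
    by rewrite fs' in fs.
  by rewrite prob_draw Ps -EFinD -natr1 mulrDl mul1r addrC.
apply/seteqP; split=> w /=; rewrite inE; first by case/orP => [/eqP|]; [left|right].
by case=> [->|->]; rewrite ?eqxx ?orbT.
Qed.

Lemma draw_event (E : F -> Prop) :
  measurable [set w | E (first_draw w)] /\
  P [set w | E (first_draw w)] = (#|[set f : F | `[< E f >]]%SET|%:R / #|{: F}|%:R)%:E.
Proof.
have := draws_in (enum_uniq [set f : F | `[< E f >]]%SET); rewrite -cardE.
rewrite (_ : [set w | _ \in enum _] = [set w | E (first_draw w)]) //.
by apply/seteqP; split=> w /=; rewrite mem_enum inE => /asboolP.
Qed.

Lemma measurable_of_draw (g : F -> \bar R) :
  measurable_fun setT (fun w => g (first_draw w) : \bar R).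
Proof.
move=> _ Y mY; rewrite setTI.
by have [] := draw_event (fun f => Y (g f)).
Qed.

(** Pointwise, [g] is at most [a] plus [b] times the indicator of [B]. *)
Lemma integral_of_draw (g : F -> \bar R) (B : {set F}) (a b : R) :
  0 <= a -> 0 <= b -> (forall f, 0 <= g f)%E ->
  (forall f, f \notin B -> (g f <= a%:E)%E) -> (forall f, (g f <= b%:E)%E) ->
  (\int[P]_w g (first_draw w) <= (a + b * (#|B|%:R / #|{: F}|%:R))%:E)%E.
Proof.
move=> a0 b0 g0 ga gb.
have [mB PB] := draw_event (fun f => f \in B).
have {}PB : P [set w | first_draw w \in B] = (#|B|%:R / #|{: F}|%:R)%:E.
  rewrite PB; congr ((_ %:R / _)%:E); congr (#|pred_of_set _|).
  by apply/setP => f; rewrite inE asboolb.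
pose bad w := first_draw w \in B.
have mi : measurable_fun setT (fun w => (\1_(bad : set Omega) w)%:E : \bar R).
  by apply/measurable_EFinP; apply: measurable_indic.
apply: (@le_trans _ _ (\int[P]_w (a%:E + b%:E * (\1_(bad : set Omega) w)%:E))%E).
  apply: ge0_le_integral => //.
  - exact: measurable_of_draw.
  - apply: emeasurable_funD; first exact: measurable_cst.
    exact: measurable_funeM.
  - move=> w _; rewrite indicE -EFinM -EFinD.
    case E : (bad w).
      rewrite (_ : w \in _) ?mulr1; last by rewrite inE.
      by apply: le_trans (gb _) _; rewrite lee_fin lerDr.
    rewrite (_ : w \in _ = false) ?mulr0 ?addr0; first by apply: ga; rewrite -/(bad w) E.
    by apply/negbTE; rewrite notin_setE /= E.
have -> : (\int[P]_w (a%:E + b%:E * (\1_(bad : set Omega) w)%:E) =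
    \int[P]_w (cst a%:E w) + \int[P]_w (b%:E * (\1_(bad : set Omega) w)%:E))%E.
  apply: ge0_integralD => //.
  - by move=> w _; rewrite -EFinM lee_fin mulr_ge0.
  - exact: measurable_funeM.
rewrite ge0_integralZl //.
rewrite integral_indic // setIT integral_cst //.
rewrite [X in (_ * X + _)%E](_ : _ = 1%E); last exact: probability_setT.
rewrite [X in (_ + _ * X)%E](_ : _ = (#|B|%:R / #|{: F}|%:R)%:E); last exact: PB.
by rewrite mule1 -EFinM -EFinD.
Qed.

End FirstDraw.

(** For [x = 2 ^ (trunc_log 2 n).+1], which exceeds [n] and is at least 2, one has
    [8 * n < 8 * x <= x ^ 4]; hence the factor 4 in the word size. *)
Lemma word_bits_large n : (0 < n)%N -> (8 * n < 2 ^ word_bits 4 n)%N.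
Proof.
move=> n0; have h := trunc_log_ltn n (isT : 1 < 2)%N.
rewrite /word_bits [(4 * _)%N]mulnC expnM; move: h.
have : (2 <= 2 ^ (trunc_log 2 n).+1)%N by rewrite expnS; have := expn_gt0 2 (trunc_log 2 n); lia.
move: (2 ^ _)%N => x x2 nx.
have : (2 ^ 3 * x <= x ^ 3 * x)%N by rewrite leq_mul2r leq_exp2r // x2 orbT.
by rewrite -expnSr; apply: leq_trans; rewrite ltn_pmul2l.
Qed.

Lemma up_log_ln (R : realType) n : (1 < n)%N ->
  (up_log 2 n)%:R <= 2 / ln 2 * ln n%:R :> R.
Proof.
move=> n1; have l2 : 0 < ln 2 :> R by rewrite ln_gt0 // ltr1n.
have L0 : (0 < up_log 2 n)%N by rewrite up_log_gt0.
have l2n : ln 2 <= ln n%:R :> R by rewrite ler_ln ?posrE ?ler_nat ?ltr0n ?(ltnW n1).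
have : ln ((2 : R) ^+ (up_log 2 n).-1) <= ln n%:R.
  by rewrite ler_ln ?posrE ?exprn_gt0 ?ltr0n ?(ltnW n1) // -natrX ler_nat ltnW // up_log_gtn.
rewrite lnXn // -[_ *+ _.-1]mulr_natr => h.
rewrite [leRHS](_ : _ = 2 * ln n%:R / ln 2); last by ring.
have -> : (up_log 2 n)%:R = (up_log 2 n).-1%:R + 1 :> R by rewrite natr1 prednK.
by rewrite ler_pdivlMr // mulrDl mul1r; lra.
Qed.

(** * Span with high probability and expected work *)

Section Main.
Variables (R : realType) (n' : nat).
Local Notation n := n'.+1.
Local Notation F := {ffun 'I_n -> 'I_n}.
Local Notation L := (up_log 2 n).
Local Notation tf := (time_factor%:R : R).
Hypothesis n_gt1 : (1 < n)%N.
Variables (disp : Order.disp_t) (T : orderType disp) (input : n.-tuple T).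
Variable adv : arbiter T 18 n.
Variables (d : measure_display) (Omega : measurableType d) (P : probability Omega R).
Variable U : nat -> 'I_n -> Omega -> 'I_n.
Hypotheses (adv_ok : valid_arbiter sort_code adv) (iid : iid_uniform P U).
Local Notation bits := (word_bits 4 n).
Local Notation elt := (tnth input).
Local Notation draws w := (fun t p => U t p w).
Local Notation replay f := (fun (_ : nat) (p : 'I_n) => (f : F) p).
Local Notation slow f := (slowest (before elt) (fun x => (f : F) x)).
Local Notation bad := ([set f : F | slow_bound n' < slow f]%N)%SET.

Let bits_large : (8 * n < 2 ^ bits)%N := word_bits_large (ltn0Sn n').

Lemma run_replay w :
  run sort_code bits adv input (draws w) =
  run sort_code bits adv input (replay (first_draw U w)).
Proof. by apply: run_first_draw; apply: funext => p; rewrite ffunE. Qed.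

Lemma L_gt0 : (0 < L)%N. Proof. by rewrite up_log_gt0. Qed.

Lemma bad_rare : #|bad|%:R / #|{: F}|%:R <= (2 * n%:R)^-1 :> R.
Proof.
have F0 : (0 < #|{: F}|)%N by apply/card_gt0P; exists [ffun=> ord0].
rewrite ler_pdivrMr ?ltr0n // mulrC ler_pdivlMr ?mulr_gt0 ?ltr0n //.
rewrite -natrM -natrM ler_nat.
by apply: few_slow; [exact: before_trans|exact: before_total].
Qed.

Lemma fast_time f : f \notin bad ->
  (time_factor * (L + slow f).+1 <= time_factor * (30 * L))%N.
Proof.
(* Off [bad] the left factor is at most [13 * L + 17], hence at most [30 * L] as [L] is positive. *)
rewrite inE -leqNgt /slow_bound => h; rewrite leq_mul2l; apply/orP; right.
have := L_gt0; lia.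
Qed.

Lemma time_ln : (time_factor * (30 * L))%N%:R <= 60 * tf / ln 2 * ln n%:R :> R.
Proof.
have := ler_wpM2l (_ : 0 <= 30 * tf) (up_log_ln R n_gt1).
rewrite !natrM => H.
have -> : 60 * tf / ln 2 * ln n%:R = 30 * tf * (2 / ln 2 * ln n%:R) :> R by ring.
have -> : tf * (30 * L%:R) = 30 * tf * L%:R by ring.
by apply: H; rewrite mulr_ge0.
Qed.

Lemma span_whp : ((1 - 1 / n%:R ^+ 1)%:E <
  P [set w | (pram_span sort_code bits adv input (draws w) R <=
              (60 * tf / ln 2 * ln n%:R)%:E)%E])%E.
Proof.
pose E (f : F) := (pram_span sort_code bits adv input (replay f) R <=
  (60 * tf / ln 2 * ln n%:R)%:E)%E.
rewrite (_ : [set w | _] = [set w | E (first_draw U w)]); last first.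
  apply/seteqP; split=> w; rewrite /E /= /pram_span /ops /running run_replay; exact.
have [_ ->] := draw_event iid E; rewrite lte_fin.
have F0 : 0 < #|{: F}|%:R :> R by rewrite ltr0n; apply/card_gt0P; exists [ffun=> ord0].
have sub : (#|{: F}| <= #|[set f : F | `[< E f >]]%SET| + #|bad|)%N.
  rewrite -cardsT; apply: leq_trans (leq_card_setU _ _).
  apply/subset_leq_card/fintype.subsetP => f _; rewrite finset.in_setU orbC.
  case: (boolP (f \in bad)) => //= fb; rewrite finset.in_set; apply/asboolP.
  apply: le_trans (span_le bits_large _ _ adv_ok R) _; rewrite lee_fin.
  by apply: le_trans time_ln; rewrite ler_nat; apply: fast_time.
have n0 : 0 < n%:R :> R by rewrite ltr0n.
(* Failure has probability at most [1 / (2 * n)], which yields the strict inequality. *)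
apply: lt_le_trans (_ : 1 - (2 * n%:R)^-1 <= _).
  rewrite expr1 div1r ltrD2l ltrN2 invfM mulrC gtr_pMr ?invr_gt0 //; lra.
rewrite lerBlDr; apply: le_trans (lerD (lexx _) bad_rare).
by rewrite -mulrDl ler_pdivlMr // mul1r -natrD ler_nat.
Qed.

(** Even on [bad] a run takes at most [time_factor * (L + n).+1] steps; the probability
    [1 / (2 * n)] reduces this contribution to [O(n)]. The constant is [2 * (30 + 2)]. *)
Lemma work_expected : (\int[P]_w pram_work sort_code bits adv input (draws w) R <=
  (64 * tf / ln 2 * (n%:R * ln n%:R))%:E)%E.
Proof.
pose W (f : F) := pram_work sort_code bits adv input (replay f) R.
rewrite (_ : (fun w => _) = (fun w => W (first_draw U w))); last first.
  by apply: funext => w; rewrite /W /pram_work /ops /running run_replay.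
apply: le_trans (integral_of_draw iid (g := W) (B := bad)
  (a := (n * (time_factor * (30 * L)))%N%:R)
  (b := (n * (time_factor * (L + n).+1))%N%:R) _ _ _ _ _) _ => //.
- by move=> f; apply: work_ge0.
- move=> f fb; apply: le_trans (work_le bits_large _ _ adv_ok R) _.
  by rewrite lee_fin ler_nat leq_mul2l fast_time.
- move=> f; apply: le_trans (work_le bits_large _ _ adv_ok R) _.
  by rewrite lee_fin ler_nat !leq_mul2l ltnS leq_add2l slowest_le !orbT.
rewrite lee_fin.
have n0 : 0 < n%:R :> R by rewrite ltr0n.
have h1 := ler_wpM2l (ler0n R (n * (time_factor * (L + n).+1))) bad_rare.
apply: le_trans (lerD (lexx _) h1) _.
have Ln : L%:R <= n%:R :> R by rewrite ler_nat up_log_min // ltnW // ltn_expl.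
have L1 : 1 <= L%:R :> R by rewrite ler1n L_gt0.
have nn : 1 <= n%:R :> R by rewrite ler1n.
have tf0 : 0 <= tf by [].
have ul := up_log_ln R n_gt1.
have -> : (n * (time_factor * (L + n).+1))%N%:R * (2 * n%:R)^-1 = tf * (L%:R + n%:R + 1) / 2 :> R.
  by rewrite !natrM -natr1 natrD; field; rewrite lt0r_neq0.
have h2 : tf * (L%:R + n%:R + 1) / 2 <= 2 * tf * n%:R * L%:R.
  rewrite -mulrA [2 * tf]mulrC -!mulrA ler_wpM2l //.
  have : n%:R <= n%:R * L%:R :> R by rewrite ler_peMr // ltW.
  lra.
have h3 : tf * n%:R * L%:R <= tf * n%:R * (2 / ln 2 * ln n%:R).
  by rewrite ler_wpM2l // mulr_ge0.
rewrite !natrM.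
have -> : 64 * tf / ln 2 * (n%:R * ln n%:R) = 32 * (tf * n%:R * (2 / ln 2 * ln n%:R)) :> R by ring.
lra.
Qed.

End Main.

Theorem theorem9 (R : realType) :
  exists (r : nat) (code : program r) (c : nat) (C_span C_work : R)
         (k n0 : nat),
    [/\ (0 < c)%N, (1 <= k)%N &
    forall (n : nat) (disp : Order.disp_t) (T : orderType disp)
           (input : n.-tuple T) (adv : arbiter T r n)
           (d : measure_display) (Omega : measurableType d)
           (P : probability Omega R) (U : nat -> 'I_n -> Omega -> 'I_n),
      let bits := word_bits c n in
      let draws := fun (w : Omega) t p => U t p w in
      valid_arbiter code adv -> iid_uniform P U ->
      {ae P, forall w, run_sorts code bits adv input (draws w)} /\
      ((n0 <= n)%N ->
        ((1 - 1 / n%:R ^+ k)%:E <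
          P [set w | (pram_span code bits adv input (draws w) R <=
                      (C_span * ln n%:R)%:E)%E])%E /\
        (\int[P]_w pram_work code bits adv input (draws w) R <=
          (C_work * (n%:R * ln n%:R))%:E)%E)].
Proof.
(* The final [2] excludes [n = 1], where [ln n = 0] although the run takes positive time. *)
exists 18%N, sort_code, 4%N, (60 * time_factor%:R / ln 2), (64 * time_factor%:R / ln 2), 1%N, 2%N.
split=> // -[|n'] disp T input adv d Omega P U bits draws adv_ok iid.
  (* For [n = 0] there are no processors, and the empty input is sorted at time 0. *)
  split=> //; apply: aeW => w; exists 0%N; split=> [[]//|].
  by exists input; split=> [||[]//]; [rewrite (tuple0 input)|exact: perm_refl].
split=> [|n1]; last by split; [exact: span_whp|exact: work_expected].
by apply: aeW => w; apply: run_sorts_input => //; apply: word_bits_large.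
Qed.
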